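(* 1) Let $\xi$ be a real algebraic number with $d=\deg\xi$, and let $L\ge 3$ be a real number with $L(\xi)\le L$. Then $$|\log2-\xi|\ge\exp\bigl\{-151000\, d^2(\log L+d\log d)(1+\log d)^{-1}\bigr\}.$$ 2) Let $d\ge1$ be an integer and $L\ge3$ a real number. If $P\in\mathbb{Z}[x]$, $P\ne0$, $\deg P\le d$ and $L(P)\le L$, then $$|P(\log2)|\ge\exp\bigl\{-2.6\cdot10^5\, d^2(\log L+d\log d)(1+\log d)^{-1}\bigr\}.$$
   Context: For a polynomial $P=\sum_{i=0}^d a_ix^i\in\mathbb{Z}[x]$ its length is $L(P)=\sum_{i=0}^d|a_i|$. For an algebraic number $\xi$, $L(\xi)$ denotes the length of its minimal polynomial in $\mathbb{Z}[x]$ (irreducible with coprime integer coefficients). Logarithms are natural. *)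

(* Defs.v *)
From mathcomp Require Import all_boot all_order all_algebra.
From mathcomp Require Import all_classical all_reals all_analysis.

Set Implicit Arguments.
Unset Strict Implicit.
Unset Printing Implicit Defensive.

Import Order.TTheory GRing.Theory Num.Theory.

Local Open Scope ring_scope.

Definition zpoly_length (P : {poly int}) : int := \sum_(i < size P) `|P`_i|.

Definition zpoly_eval (R : realType) (P : {poly int}) (x : R) : R :=
  (map_poly intr P).[x].

Definition algebraic_number (R : realType) (xi : R) : Prop :=
  algebraicOver (ratr : rat -> R) xi.

(* Divisibility of polynomials over an integral domain is that of              *)
(* pseudo-division, so [irreducible_poly P] says that P is irreducible in      *)
(* Q[x]; with content 1 this is irreducibility in Z[x]. [zcontents P] carries  *)
(* the sign of the leading coefficient, so [zcontents P = 1] also fixes the    *)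
(* sign of P (the length and the degree do not depend on it).                  *)
Definition is_minpolyZ (R : realType) (xi : R) (P : {poly int}) : Prop :=
  [/\ irreducible_poly P, zcontents P = 1 & zpoly_eval P xi = 0].

Definition minpolyZ (R : realType) (xi : R) : {poly int} :=
  xget 0 [set P | is_minpolyZ xi P]%classic.

Definition alg_degree (R : realType) (xi : R) : nat := (size (minpolyZ xi)).-1.

Definition alg_length (R : realType) (xi : R) : int :=
  zpoly_length (minpolyZ xi).

Lemma zpoly_evalM (R : realType) (P Q : {poly int}) (xi : R) :
  zpoly_eval (P * Q) xi = zpoly_eval P xi * zpoly_eval Q xi.
Proof. by rewrite /zpoly_eval rmorphM hornerM. Qed.

Lemma zpoly_evalD (R : realType) (P Q : {poly int}) (xi : R) :
  zpoly_eval (P + Q) xi = zpoly_eval P xi + zpoly_eval Q xi.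
Proof. by rewrite /zpoly_eval rmorphD hornerD. Qed.

Lemma zpoly_evalZ (R : realType) (c : int) (P : {poly int}) (xi : R) :
  zpoly_eval (c *: P) xi = c%:~R * zpoly_eval P xi.
Proof. by rewrite /zpoly_eval map_polyZ hornerZ. Qed.

Lemma zpoly_evalC (R : realType) (c : int) (xi : R) :
  zpoly_eval c%:P xi = c%:~R.
Proof. by rewrite /zpoly_eval map_polyC hornerC. Qed.

Lemma is_minpolyZ_exists (R : realType) (xi : R) :
  algebraic_number xi -> exists P, is_minpolyZ xi P.
Proof.
move=> [p p0 rp].
pose ann (n : nat) :=
  `[< exists P : {poly int}, [/\ P != 0, zpoly_eval P xi = 0 & size P = n] >].
have exann : exists n, ann n.
  have [q [a a0 pE]] := rat_poly_scale p.
  exists (size q); apply/asboolP; exists q; split=> //.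
    by apply: contraNneq p0 => q0; rewrite pE q0 rmorph0 scaler0.
  move: rp; rewrite pE map_polyZ rootZ; last first.
    by rewrite fmorph_eq0 invr_eq0 intr_eq0.
  rewrite -map_poly_comp => /rootP <-; congr (_ .[_]).
  by apply: eq_map_poly => z /=; rewrite ratr_int.
case: (ex_minnP exann) => n /asboolP [P0 [P0n0 P0xi sP0]] nmin.
have minP (Q : {poly int}) : Q != 0 -> zpoly_eval Q xi = 0 -> (n <= size Q)%N.
  by move=> Q0 Qxi; apply: nmin; apply/asboolP; exists Q.
pose P := zprimitive P0.
have Pn0 : P != 0 by rewrite zprimitive_eq0.
have sP : size P = n by rewrite size_zprimitive.
have Pxi : zpoly_eval P xi = 0.
  move: P0xi; rewrite [P0 in zpoly_eval P0]zpolyEprim zpoly_evalZ => /eqP.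
  by rewrite mulf_eq0 intr_eq0 zcontents_eq0 (negPf P0n0) => /eqP.
exists P; split; [|by rewrite zcontents_primitive P0n0|by []].
split.
  rewrite ltnNge; apply/negP => /size1_polyC PE.
  move: Pxi Pn0; rewrite PE zpoly_evalC => /eqP.
  by rewrite intr_eq0 => /eqP ->; rewrite polyC0 eqxx.
move=> q sq1 qP; rewrite -dvdp_size_eqp // eqn_leq.
have q0 : q != 0 by apply: contraTneq qP => ->; rewrite dvd0p.
rewrite dvdp_leq //= sP.
have /Pdiv.Idomain.dvdpP [[c r] /= c0 cE] := qP.
have cP0 : c *: P != 0 by rewrite -size_poly_eq0 size_scale // size_poly_eq0.
have r0 : r != 0 by apply: contraNneq cP0 => r0; rewrite cE r0 mul0r.
have : zpoly_eval r xi * zpoly_eval q xi = 0.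
  by rewrite -zpoly_evalM -cE zpoly_evalZ Pxi mulr0.
move=> /eqP; rewrite mulf_eq0 => /orP[] /eqP e0; last exact: minP.
have := minP _ r0 e0; have := congr1 (size \o polyseq) cE => /=.
rewrite size_scale // size_mul // sP => nE rn.
have sq : (1 < size q)%N by rewrite ltn_neqAle eq_sym sq1 size_poly_gt0.
move: nE rn sq; case: (size q) => [|[|k]] // -> .
by rewrite !addnS /= ltnNge leq_addr.
Qed.

Lemma is_minpolyZ_unique (R : realType) (xi : R) (P Q : {poly int}) :
  is_minpolyZ xi P -> is_minpolyZ xi Q -> P = Q.
Proof.
move=> [iP cP Px] [iQ cQ Qx].
have g1 : size (gcdp P Q) != 1%N.
  apply/negP => /Pdiv.Idomain.Bezout_coprimepP [[u v] /= ].
  rewrite -size_poly_eq1 => /eqP /eqP /size_poly1P [c c0 e].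
  have := congr1 (fun S => zpoly_eval S xi) e.
  rewrite zpoly_evalD !zpoly_evalM Px Qx !mulr0 addr0 zpoly_evalC => /esym/eqP.
  by rewrite intr_eq0 (negPf c0).
have /eqpP [[a b] /= /andP[a0 b0] e] : P %= Q.
  apply: (eqp_trans (y := gcdp P Q)); last by apply: iQ.2 => //; apply: dvdp_gcdr.
  by rewrite eqp_sym; apply: iP.2 => //; apply: dvdp_gcdl.
have := congr1 zcontents e; rewrite !zcontentsZ cP cQ !mulr1 => ab.
move: e; rewrite ab -!mul_polyC; apply: mulfI.
by rewrite polyC_eq0 -ab.
Qed.

Lemma minpolyZP (R : realType) (xi : R) :
  algebraic_number xi -> is_minpolyZ xi (minpolyZ xi).
Proof. by move=> /is_minpolyZ_exists exP; apply: (xgetPex 0 exP). Qed.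

Lemma minpolyZ_eq (R : realType) (xi : R) (P : {poly int}) :
  is_minpolyZ xi P -> minpolyZ xi = P.
Proof.
by move=> mP; apply: xget_unique => // Q mQ; apply: is_minpolyZ_unique mQ mP.
Qed.

(* Main.v *)
(* Interpolation determinants. Let xi be a real root of an irreducible P. The *)
(* functions z^i e^(jz), i < L0, j < L1, are interpolated at s log 2, s < S,  *)
(* through the coefficients of w^t, t < T, in (s x + log(1+w))^i 2^(sj)       *)
(* (1+w)^j, where x = log 2 for the true values and x = xi otherwise. A zero  *)
(* estimate gives a minor which does not vanish for x = xi. If xi is very     *)
(* close to log 2, that minor is tiny: expand every row in powers of z, up to *)
(* a small remainder; in the expansion of the determinant distinct rows must  *)
(* use distinct powers. On the other hand, multiplied by a common denominator *)
(* it is an integer polynomial in xi, hence bounded from below through its    *)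
(* resultant with P. Taking the derivatives (d/dy)^t / t! with y = e^z rather *)
(* than (d/dz)^t costs only the denominators of powers of log(1+w), and saves *)
(* a factor log log L. A small value at log 2 of an irreducible polynomial    *)
(* forces a real root nearby, because its derivative is not small there; in   *)
(* general factor, the product of the lengths of the factors being controlled *)
(* by Landau's inequality for the Mahler measure.                             *)
Require Import Defs.
From mathcomp Require Import all_boot all_order all_algebra.
From mathcomp Require Import all_classical all_reals all_analysis.
From mathcomp Require Import perm algC zify ring lra.
From mathcomp.real_closed Require polyorder.

Set Implicit Arguments.
Unset Strict Implicit.
Unset Printing Implicit Defensive.

Import Order.TTheory GRing.Theory Num.Theory.

(** * Least common multiples *)

(** Write l = 1 + log d and W = log L + d log d, so that the exponent is a constant times q = d^2 W
    / l. Everything rests on [real_root_measure]: every real root [xi] of an irreducible integer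
    polynomial P of degree d and length at most L lies at distance at least exp(-61000 q) from log
    2.

    Its proof evaluates one determinant of order N = L0 L1 in two ways. The entries are Taylor
    coefficients of the functions z^i e^(jz) at the points s log 2, in which log 2 is replaced by
    [xi] outside the exponential; since e^(j s log 2) = 2^(sj) is rational, they are polynomials in
    [xi] with rational coefficients. If [xi] is within E^(-N) / L0 of log 2, the replacement costs
    no more than cutting the power series of the functions after N terms. Rows that use distinct
    powers of z gain a factor E each time the power rises, so the determinant is about E^(-N(N-1)/2)
    ([minor_det_le]). Conversely, after multiplication by a power of [prod_lcm] it is Q([xi]) with Q
    an integer polynomial ([minor_zpoly]). If it is not 0, then P and Q are coprime, their resultant
    is a nonzero integer, and |Q([xi])| is bounded from below ([coprimep_eval_ge]). A nonzero minor
    exists by [entry_minor], which rests on [zero_estimate]: the Wronskian of functions p_i(z)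
    e^(e_i z) is, up to an exponential, a polynomial of controlled degree whose top coefficient
    contains a Vandermonde determinant. The two bounds give [core_inequality], and
    [parameter_inequality] contradicts it when E = e d and the sizes are chosen as multiples of d, d
    / l and W / l; then N log E is at most 57600 q.

    For values of polynomials, an irreducible P which is tiny at log 2 has a derivative that is not
    tiny there, because the resultant of P and P' is a nonzero integer; so P has a real root very
    near log 2, against the first result ([irreducible_eval_measure]). A general P is split into
    irreducible factors. Their degrees add up to at most d, and the Mahler measure shows that the
    product of their lengths is at most 2^d L ([prod_zpoly_length_le]), so the bounds for the
    factors multiply to a bound of the same shape ([eval_measure]). *)

Definition lcm_upto n := \big[lcmn/1%N]_(1 <= i < n.+1) i.

Lemma dvdn_lcm_upto m n : 0 < m <= n -> m %| lcm_upto n.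
Proof.
move=> mn; rewrite /lcm_upto (@big_cat_nat _ _ _ m.+1) //=; last by lia.
rewrite big_nat_recr //=; last by lia.
exact: dvdn_trans (dvdn_lcmr _ _) (dvdn_lcml _ _).
Qed.

Lemma lcm_upto_dvd n k :
  (forall m, 0 < m <= n -> m %| k) -> lcm_upto n %| k.
Proof.
move=> H; rewrite /lcm_upto big_nat; elim/big_ind: _ => //.
by move=> x y xk yk; rewrite dvdn_lcm xk.
Qed.

Lemma lcm_upto_gt0 n : 0 < lcm_upto n.
Proof.
rewrite /lcm_upto big_nat; elim/big_ind: _ => //.
  by move=> x y; rewrite lcmn_gt0 => -> ->.
by move=> i /andP[].
Qed.

(** Legendre's formula: each p^k contributes floor(2n/p^k) - 2 floor(n/p^k) >= 0 to the exponent of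
    p in the binomial coefficient, and the contribution of p^a is positive. *)
Lemma prime_dvd_central_bin p a n :
  prime p -> n < p ^ a <= n.*2 -> p %| 'C(n.*2, n).
Proof.
move=> pp /andP[na an].
have a0 : 0 < a by case: a na an => // na an; lia.
have C0 : 0 < 'C(n.*2, n) by rewrite bin_gt0; lia.
have /(congr1 (logn p)) := @bin_fact n.*2 n ltac:(lia).
have -> : n.*2 - n = n by lia.
rewrite !lognM ?muln_gt0 ?fact_gt0 // !logn_fact //.
have n1 : n < n.*2.+1 by lia.
rewrite [in RHS](@big_cat_nat _ _ _ n.+1) //= => Hs.
have ext : \sum_(1 <= k < n.*2.+1) n %/ p ^ k = \sum_(1 <= k < n.+1) n %/ p ^ k.
  rewrite (@big_cat_nat _ _ _ n.+1) //= [X in _ + X]big1_seq ?addn0 // => i.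
  rewrite mem_index_iota /= => /andP[ni _]; apply: divn_small.
  by apply: (leq_trans ni); apply/ltnW/ltn_expl/prime_gt1.
move: Hs; rewrite -(@big_cat_nat _ _ _ n.+1) //= -ext -big_split /= => Hs.
have a2 : a < n.*2.+1.
  by have := ltn_expl a (prime_gt1 pp); lia.
have : \sum_(1 <= k < n.*2.+1) (n %/ p ^ k + n %/ p ^ k) <
       \sum_(1 <= k < n.*2.+1) n.*2 %/ p ^ k.
  rewrite (bigD1_seq a) ?iota_uniq //=; last by rewrite mem_index_iota a0.
  rewrite [X in _ < X](bigD1_seq a) ?iota_uniq //=; last by rewrite mem_index_iota a0.
  rewrite (divn_small na) addn0 add0n -add1n leq_add //.
    by rewrite divn_gt0 ?expn_gt0 ?prime_gt0.
  apply: leq_sum => k _; rewrite -addnn;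
    by rewrite (divnD _ _ _) ?expn_gt0 ?prime_gt0 // leq_addr.
rewrite -Hs -[X in X < _]add0n ltn_add2r logn_gt0 mem_primes => /and3P[] //.
Qed.

(** A prime power p^a <= 2n is either at most n, or p^(a-1) <= n and the missing factor p comes from
    the central binomial coefficient. *)
Lemma lcm_upto_double n : lcm_upto n.*2 %| lcm_upto n * 'C(n.*2, n).
Proof.
apply: lcm_upto_dvd => m /andP[m0 mn]; apply/dvdn_partP => // p pm.
have pp : prime p by move: pm; rewrite mem_primes => /and3P[].
rewrite p_part; set a := logn p m.
have a0 : 0 < a by rewrite logn_gt0.
have am : p ^ a <= n.*2.
  by apply: leq_trans mn; apply: dvdn_leq => //; apply: pfactor_dvdnn.
have [an|na] := leqP (p ^ a) n.
  by apply: dvdn_mulr; apply: dvdn_lcm_upto; rewrite an expn_gt0 prime_gt0.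
rewrite -(prednK a0) expnSr; apply: dvdn_mul; last first.
  by apply: (prime_dvd_central_bin (a := a)); rewrite // na.
apply: dvdn_lcm_upto; rewrite expn_gt0 prime_gt0 //=.
move: am; rewrite -{1}(prednK a0) expnS => am.
have := prime_gt1 pp; nia.
Qed.

Lemma bin_le_exp2 n k : 'C(n, k) <= 2 ^ n.
Proof.
have [kn|nk] := leqP k n; last by rewrite bin_small // expn_gt0.
have -> : 2 ^ n = \sum_(i < n.+1) 'C(n, i).
  rewrite -[2]/(1 + 1) Pascal; apply: eq_bigr => i _.
  by rewrite !exp1n !muln1.
by rewrite (bigD1 (Ordinal (kn : k < n.+1))) //= leq_addr.
Qed.

(** Halving n to m costs a factor 4^m, whereas 8^m is available; the spare 2^m pays for the extra
    factor 2m + 1 when n is odd. *)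
Lemma lcm_upto_le n : lcm_upto n <= 8 ^ n.
Proof.
have [k] := ubnP n; elim: k n => // k IH n nk.
have [->|n0] := posnP n; first by rewrite /lcm_upto big_nil.
have {}IH : lcm_upto n./2 <= 8 ^ n./2 by apply: IH; lia.
have D : lcm_upto (n./2).*2 <= 8 ^ n./2 * 4 ^ n./2.
  apply: leq_trans (dvdn_leq _ (lcm_upto_double _)) _.
    by rewrite muln_gt0 lcm_upto_gt0 bin_gt0; lia.
  apply: leq_mul => //; apply: leq_trans (bin_le_exp2 _ _) _.
  by rewrite -mul2n expnM.
have e48 : 8 ^ n./2 = 4 ^ n./2 * 2 ^ n./2 by rewrite -expnMn.
have h2 : n./2 < 2 ^ n./2 by apply: ltn_expl.
have c0 : 0 < 4 ^ n./2 by rewrite expn_gt0.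
have [oddn|evn] := boolP (odd n); last first.
  have {1}-> : n = (n./2).*2 by lia.
  apply: leq_trans D _.
  have -> : 8 ^ n = 8 ^ n./2 * 8 ^ n./2 by rewrite -expnD; congr (_ ^ _); lia.
  by rewrite leq_mul2l leq_exp2r; lia.
have nE : n = (n./2).*2.+1 by lia.
rewrite {1}nE /lcm_upto big_nat_recr //= -/(lcm_upto _).
apply: (@leq_trans (lcm_upto n./2.*2 * (n./2).*2.+1)).
  by apply: dvdn_leq; [rewrite muln_gt0 lcm_upto_gt0|rewrite dvdn_lcm dvdn_mulr
    ?dvdn_mull].
have -> : 8 ^ n = 8 ^ n./2 * (8 * 8 ^ n./2).
  by rewrite -expnS -expnD; congr (_ ^ _); lia.
apply: (@leq_trans (8 ^ n./2 * 4 ^ n./2 * (n./2).*2.+1));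
  first by rewrite leq_mul2r D orbT.
rewrite -mulnA leq_mul2l {2}e48; apply/orP; right; nia.
Qed.

(** A common denominator for the coefficients of degree at most T of log(1+w)^k, k <= K. Its
    logarithm is of order T (1 + log K), whereas that of the K-th power of [lcm_upto T] would be of
    order T K. *)
Definition prod_lcm K T := \prod_(1 <= l < K.+1) lcm_upto (T %/ l).

Lemma prod_lcm_gt0 K T : 0 < prod_lcm K T.
Proof. by rewrite prodn_gt0 // => i; apply: lcm_upto_gt0. Qed.

(* In decreasing order the l-th term of a list of positive integers of sum at *)
(* most T is at most T / l.                                                   *)
Lemma prod_dvd_prod_lcm K T (s : seq nat) :
  all (leq 1) s -> size s <= K -> sumn s <= T ->
  \prod_(a <- s) a %| prod_lcm K T.
Proof.
elim: K s => [|K IH] s s1 sK sT.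
  by move: sK; rewrite leqn0 size_eq0 => /eqP ->; rewrite big_nil dvd1n.
have [sK'|sK'] := leqP (size s) K.
  by rewrite /prod_lcm big_nat_recr //= dvdn_mulr // IH.
have sE : size s = K.+1 by lia.
have [m [ms mmin]] : exists m, m \in s /\ forall a, a \in s -> m <= a.
  case: s sE {s1 sK sT sK'} => // a s _.
  elim: s a => [|b s IHs] a; first by exists a; rewrite inE eqxx; split=> // c;
    rewrite inE => /eqP->.
  have [m [ms mm]] := IHs b.
  have [am|ma] := leqP a m.
    exists a; rewrite inE eqxx; split=> // c; rewrite inE => /orP[/eqP->//|/mm]; lia.
  exists m; rewrite inE ms orbT; split=> // c; rewrite inE => /orP[/eqP->|/mm//];
    exact: ltnW.
have m0 : 0 < m by move/allP: s1; apply.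
have mS : m * K.+1 <= sumn s.
  rewrite -sE; elim: (s) mmin => [|a s' IHs] mm /=; first by rewrite muln0.
  rewrite mulnS leq_add ?mm ?mem_head // IHs // => c cs; apply: mm.
  by rewrite inE cs orbT.
have ps := perm_to_rem ms.
rewrite (perm_big _ ps) big_cons /= /prod_lcm big_nat_recr //= mulnC dvdn_mul //.
  apply: IH.
  - by move: s1; rewrite (perm_all _ ps) /= => /andP[].
  - by rewrite size_rem // sE.
  - by move: sT; rewrite (perm_sumn ps) /=; lia.
by apply: dvdn_lcm_upto; rewrite m0 leq_divRL //; lia.
Qed.

Local Open Scope ring_scope.

(** * The truncated logarithm series *)

Lemma dvdXnP (F : fieldType) n (p : {poly F}) :
  reflect (forall i, (i < n)%N -> p`_i = 0) ('X^n %| p).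
Proof.
apply: (iffP idP) => [/dvdpP[q ->] i ni|H]; first by rewrite coefMXn ni.
have -> : p = drop_poly n p * 'X^n.
  rewrite -{1}(poly_take_drop n p) -[RHS]add0r; congr (_ + _).
  by apply/polyP => i; rewrite coef_take_poly coef0; case: ltnP => // /H.
exact: dvdp_mulIr.
Qed.

(* The coefficient of index 0 is 0, because 0^-1 = 0. *)
Definition log1p_poly (R : fieldType) T : {poly R} :=
  \poly_(a < T) ((-1) ^+ a.-1 / a%:R).

(** * Coefficientwise majorants *)

Section Majorant.
Variable R : realDomainType.
Implicit Types p q P Q : {poly R}.

(** Compatible with sums and products; evaluating P at 1/2 then bounds single coefficients, and
    evaluating it at 1 bounds lengths. *)
Definition majorant p P := forall i, `|p`_i| <= P`_i.

Lemma majorant_ge0 p P : majorant p P -> forall i, 0 <= P`_i.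
Proof. by move=> h i; apply: le_trans (h i). Qed.

Lemma majorantD p P q Q : majorant p P -> majorant q Q -> majorant (p + q) (P + Q).
Proof. by move=> hp hq i; rewrite !coefD (le_trans (ler_normD _ _)) // lerD. Qed.

Lemma majorantM p P q Q : majorant p P -> majorant q Q -> majorant (p * q) (P * Q).
Proof.
move=> hp hq i; rewrite !coefM (le_trans (ler_norm_sum _ _ _)) //.
by apply: ler_sum => k _; rewrite normrM ler_pM.
Qed.

Lemma majorantC (c C : R) : `|c| <= C -> majorant c%:P C%:P.
Proof. by move=> cC i; rewrite !coefC; case: eqP; rewrite // normr0. Qed.

Lemma majorantX p P n : majorant p P -> majorant (p ^+ n) (P ^+ n).
Proof.
move=> h; elim: n => [|n IH]; first by rewrite !expr0; apply: majorantC; rewrite normr1.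
by rewrite !exprS; apply: majorantM.
Qed.

Lemma majorant_1DX : majorant (1 + 'X) (1 + 'X).
Proof.
by move=> i; rewrite coefD coefX coef1; case: i => [|[|i]] /=;
  rewrite ?addr0 ?add0r ?normr1 ?normr0.
Qed.

End Majorant.

Section LogPoly.
Variable R : realType.
Implicit Types (p q P Q : {poly R}) (T : nat).

Lemma log1p_poly0 T : (log1p_poly R T)`_0 = 0.
Proof. by rewrite coef_poly invr0 mulr0 if_same. Qed.

Lemma dvdX_log1p_poly T : 'X %| log1p_poly R T.
Proof. by rewrite -['X]expr1; apply/dvdXnP => -[|//] _; apply: log1p_poly0. Qed.

Lemma coef_1DX_mul p i : ((1 + 'X) * p)`_i.+1 = p`_i.+1 + p`_i.
Proof. by rewrite mulrDl mul1r coefD coefXM. Qed.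

Lemma coef0_1DX_mul p : ((1 + 'X) * p)`_0 = p`_0.
Proof. by rewrite mulrDl mul1r coefD coefXM addr0. Qed.

Lemma deriv_log1p_poly T : 'X^T %| (1 + 'X) * (log1p_poly R T.+1)^`() - 1.
Proof.
have cE i : (i < T)%N -> (log1p_poly R T.+1)^`()`_i = (-1) ^+ i.
  move=> iT; rewrite coef_deriv coef_poly ltnS iT /= -[_ *+ _]mulr_natr divfK //.
apply/dvdXnP => -[|i] iT; rewrite coefB coef1 /=.
  by rewrite coef0_1DX_mul cE // subrr.
by rewrite coef_1DX_mul !cE ?(ltnW iT) // exprS mulN1r addNr subr0.
Qed.

(** The equation (1 + X) y' = c y determines y_(i+1) from y_i through (i+1) y_(i+1) = (c - i) y_i,
    so the constant term determines y modulo X^(T+1). *)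
Lemma eq_mod_Xn_ode (c : R) T p q :
  'X^T %| (1 + 'X) * p^`() - c *: p -> 'X^T %| (1 + 'X) * q^`() - c *: q ->
  p`_0 = q`_0 -> 'X^(T.+1) %| p - q.
Proof.
move=> /dvdXnP hp /dvdXnP hq pq0.
suff H i : (i < T.+1)%N -> p`_i = q`_i.
  by apply/dvdXnP => i iT; rewrite coefB H // subrr.
elim: i => [//|i IH] iT; have pqi := IH (ltnW iT).
have i0 : (i.+1%:R : R) != 0 by rewrite pnatr_eq0.
move: (hp i iT) (hq i iT) => /eqP + /eqP; rewrite !coefB !coefZ !subr_eq0.
case: i iT IH pqi i0 => [|i] iT IH pqi i0.
  rewrite !coef0_1DX_mul !coef_deriv pqi => /eqP e1 /eqP e2.
  by apply/(mulIf i0); rewrite !mulr_natr e1 e2.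
rewrite !coef_1DX_mul !coef_deriv pqi => /eqP <-.
by rewrite (inj_eq (addIr _)) -!(mulr_natr _`_i.+2) (inj_eq (mulIf i0)) => /eqP.
Qed.

(* Modulo X^T both sides solve (1 + X) y' = j y with y(0) = 1. *)
Lemma exp_log1p_poly T j :
  'X^(T.+1) %| (1 + 'X) ^+ j -
    \sum_(m < T.+1) (j%:R ^+ m / m`!%:R) *: log1p_poly R T.+1 ^+ m.
Proof.
set l := log1p_poly R T.+1.
have lX m : 'X^m %| l ^+ m by apply: dvdp_exp2r; apply: dvdX_log1p_poly.
have l0 m : (l ^+ m.+1)`_0 = 0.
  by have /dvdXnP -> := lX m.+1.
apply: (@eq_mod_Xn_ode j%:R).
- rewrite deriv_exp derivD derivC derivX add0r mul1r.
  case: j => [|j] /=; first by rewrite mulr0n mulr0 scale0r subrr dvdp0.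
  by rewrite mulrnAr -exprS scaler_nat subrr dvdp0.
- set G := \sum_(m < _) _ *: _; set G' := \sum_(m < T) (j%:R ^+ m / m`!%:R) *: l ^+ m.
  have dG : G^`() = j%:R *: G' * l^`().
    rewrite /G raddf_sum big_ord_recl /= expr0 derivZ derivC scaler0 add0r.
    rewrite scaler_sumr mulr_suml; apply: eq_bigr => m _.
    rewrite derivZ deriv_exp /= /bump leq0n add1n add0n.
    have -> : l^`() * l ^+ m *+ m.+1 = m.+1%:R *: (l^`() * l ^+ m) by rewrite
      scaler_nat.
    rewrite !scalerA -scalerAl [l ^+ m * _]mulrC; congr (_ *: _).
    have m0 : (m.+1%:R : R) != 0 by rewrite pnatr_eq0.
    have f0 : (m`!%:R : R) != 0 by rewrite pnatr_eq0 -lt0n fact_gt0.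
    rewrite factS natrM exprS; field.
    by rewrite f0 addrC natr1 m0.
  rewrite dG.
  have -> : G = G' + (j%:R ^+ T / T`!%:R) *: l ^+ T by rewrite /G big_ord_recr.
  set c := _ / _.
  have -> : (1 + 'X) * (j%:R *: G' * l^`()) - j%:R *: (G' + c *: l ^+ T) =
    j%:R *: G' * ((1 + 'X) * l^`() - 1) - (j%:R * c) *: l ^+ T.
    by rewrite scalerDr scalerA -!mul_polyC; ring.
  apply: dvdp_sub; first by apply: dvdp_mull; apply: deriv_log1p_poly.
  by rewrite -mul_polyC; apply: dvdp_mull.
- rewrite big_ord_recl expr0 fact0 divr1 scale1r coefD coef_sum big1 ?addr0 => [|i _].
    by rewrite -!horner_coef0 horner_exp hornerD !hornerC hornerX addr0 expr1n.
  by rewrite coefZ l0 mulr0.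
Qed.

Lemma majorant_coef p P t : majorant p P -> `|p`_t| <= 2 ^+ t * P.[1/2].
Proof.
move=> h; apply: le_trans (h t) _.
have P0 := majorant_ge0 h.
have [tP|Pt] := ltnP t (size P); last first.
  rewrite nth_default // mulr_ge0 ?exprn_ge0 // horner_coef.
  by apply: sumr_ge0 => i _; rewrite mulr_ge0 ?exprn_ge0.
rewrite horner_coef (bigD1 (Ordinal tP)) //= mulrDr.
have -> : 2 ^+ t * (P`_t * (1 / 2) ^+ t) = P`_t.
  by rewrite mulrCA -exprMn mul1r divff // expr1n mulr1.
rewrite lerDl.
rewrite mulr_ge0 ?exprn_ge0 //.
by apply: sumr_ge0 => i _; rewrite mulr_ge0 ?exprn_ge0.
Qed.

(** The truncated series of -log(1 - X). *)
Definition log1p_majorant T : {poly R} := \poly_(a < T) (a%:R^-1).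

Lemma majorant_log1p T : majorant (log1p_poly R T) (log1p_majorant T).
Proof.
move=> i; rewrite !coef_poly; case: ifP; rewrite ?normr0 // => _.
by rewrite normrM normrX normrN normr1 expr1n mul1r ger0_norm // invr_ge0.
Qed.

Lemma log1p_majorant_half T : (log1p_majorant T).[1/2] <= 1.
Proof.
rewrite horner_poly.
(* The terms are at most those of a geometric series; keeping its remainder makes the induction
   work. *)
suff: \sum_(i < T) (i%:R^-1 * (1 / 2) ^+ i) <= 1 - (1/2 : R) ^+ T.-1.
  by move=> h; apply: le_trans h _; rewrite gerBl exprn_ge0.
elim: T => [|T IH]; first by rewrite big_ord0 expr0 subrr.
rewrite big_ord_recr /=; case: T IH => [|T] IH;
  first by rewrite big_ord0 invr0 mul0r addr0 expr0 subrr.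
have h : T.+1%:R^-1 * (1 / 2) ^+ T.+1 <= (1 / 2 : R) ^+ T.+1.
  by rewrite ler_piMl ?exprn_ge0 // invf_le1 ?ltr0n // ler1n.
apply: le_trans (lerD IH h) _; rewrite /= [(1 / 2) ^+ T.+1]exprS.
by rewrite -addrA lerD2l -{1}[(1 / 2) ^+ T]mul1r -mulNr -mulrDl -mulNr ler_wpM2r
  ?exprn_ge0 //; lra.
Qed.

(** Each of the k factors log(1+w) contributes a denominator equal to the degree taken from it. The
    induction removes one factor, of degree a, and passes to L / a, which has the divisibility
    property for k - 1 factors of total degree t - a. *)
Lemma int_coef_log1p_poly_exp T j k t (L : nat) : (t < T)%N ->
  (forall s : seq nat, all (leq 1) s -> (size s <= k)%N -> (sumn s <= t)%N ->
     (\prod_(a <- s) a %| L)%N) ->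
  L%:R * (log1p_poly R T ^+ k * (1 + 'X) ^+ j)`_t \is a Num.int.
Proof.
elim: k t L => [|k IH] t L tT H.
  rewrite expr0 mul1r rpredM ?rpred_nat // .
  rewrite exprDn coef_sum rpred_sum // => i _.
  by rewrite expr1n mul1r coefMn coefXn rpredMn // rpred_nat.
rewrite exprS -mulrA coefM mulr_sumr rpred_sum // => -[a /= at1] _.
case: a at1 => [|a] at1; first by rewrite log1p_poly0 mul0r mulr0 rpred0.
have aL : (a.+1 %| L)%N.
  by have := H [:: a.+1]; rewrite big_seq1 /= addn0; apply => //; lia.
rewrite coef_poly ifT; last by lia.
rewrite mulrA.
have -> : L%:R * ((-1) ^+ a.+1.-1 / a.+1%:R) = (-1) ^+ a * (L %/ a.+1)%:R :> R.
  by rewrite natf_div //= mulrCA mulrA.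
rewrite -mulrA rpredM ?rpredX ?rpredN ?rpred1 // IH //; first by lia.
move=> s s1 sk st; rewrite dvdn_divRL // mulnC.
have := H (a.+1 :: s); rewrite big_cons /=; apply => //; lia.
Qed.

End LogPoly.

(** * The zero estimate *)

Lemma coef_mul_top (F : comNzRingType) (p q : {poly F}) m n :
  (size p <= m.+1)%N -> (size q <= n.+1)%N ->
  (size (p * q)%R <= (m + n).+1)%N /\ (p * q)`_(m + n) = p`_m * q`_n.
Proof.
move=> pm qn; split.
  by apply: leq_trans (size_polyMleq _ _) _; lia.
have mi : (m < (m + n).+1)%N by rewrite ltnS leq_addr.
rewrite coefM (bigD1 (Ordinal mi)) //= addKn big1 ?addr0 // => i im.
have {}im : (i : nat) != m by apply: contra im => /eqP im; apply/eqP/val_inj.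
have [mi'|im'] := ltnP m i; first by rewrite [p`_i]nth_default ?mul0r // (leq_trans pm).
by rewrite [q`__]nth_default ?mulr0 // (leq_trans qn) //; lia.
Qed.

Lemma coef_prod_top (F : comNzRingType) n (f : 'I_n -> {poly F}) (D : 'I_n -> nat) :
  (forall i, size (f i) <= (D i).+1)%N ->
  (size (\prod_i f i)%R <= (\sum_i D i).+1)%N /\
  (\prod_i f i)`_(\sum_i D i) = \prod_i (f i)`_(D i).
Proof.
move=> h; elim/big_rec3: _ => [|i c N p _ [sp <-]].
  by rewrite size_poly1 coef1.
exact: coef_mul_top.
Qed.

Section ZeroEstimate.
Variable R : realType.

(* The derivation acting on the factor p of p(z) e^(ez). *)
Definition twist_deriv (e : nat) (p : {poly R}) := p^`() + e%:R *: p.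

Lemma twist_deriv_top e k (p : {poly R}) D : (size p <= D.+1)%N ->
  (size (iter k (twist_deriv e) p) <= D.+1)%N /\
  (iter k (twist_deriv e) p)`_D = e%:R ^+ k * p`_D.
Proof.
move=> pD; elim: k => [|k [IHs IHc]] /=; first by rewrite expr0 mul1r.
rewrite /twist_deriv; set q := iter _ _ _ in IHs IHc *; split.
  apply: leq_trans (size_polyD _ _) _; rewrite geq_max.
  rewrite (leq_trans (size_scale_leq _ _)) // andbT.
  have [q0|/lt_size_deriv/ltnW dq] := eqVneq q 0; last exact: leq_trans dq IHs.
  by rewrite q0 deriv0 size_poly0.
by rewrite coefD coefZ coef_deriv (@nth_default _ 0 _ D.+1) // mul0rn add0r IHc exprS
  mulrA.
Qed.

Definition twist_mx n (e : 'I_n -> nat) (p : 'I_n -> {poly R}) : 'M[{poly R}]_n :=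
  \matrix_(k, i) iter k (twist_deriv (e i)) (p i).

(** In top degree [twist_deriv] only multiplies by e_i, so the coefficient of degree sum deg p_i is
    the Vandermonde determinant of the e_i times the leading coefficients of the p_i. *)
Lemma det_twist_mx n (e : 'I_n -> nat) (p : 'I_n -> {poly R}) :
  injective e -> (forall i, p i != 0) ->
  \det (twist_mx e p) != 0 /\
  (size (\det (twist_mx e p)) <= (\sum_i (size (p i)).-1).+1)%N.
Proof.
move=> e_inj p0; set W := \det _; set D := fun i => (size (p i)).-1.
have sp i : (size (p i) <= (D i).+1)%N by rewrite /D; lia.
have WE : W = \sum_(s : 'S_n) (-1) ^+ s * \prod_i iter (s i) (twist_deriv (e i)) (p i).
  rewrite /W -det_tr; apply: eq_bigr => s _; congr (_ * _).
  by apply: eq_bigr => i _; rewrite !mxE.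
have top := fun s : 'S_n => coef_prod_top (fun i => (twist_deriv_top (e i) (s i) (sp
  i)).1).
have sgnE (s : 'S_n) (q : {poly R}) : (-1) ^+ s * q = (-1) ^+ s *: q :> {poly R}.
  by case: (odd_perm s); rewrite ?expr1 ?expr0 ?scaleN1r ?mulN1r ?scale1r ?mul1r.
split; last first.
  rewrite WE; apply: (leq_trans (size_sum _ _ _)); apply/bigmax_leqP => s _.
  by rewrite sgnE (leq_trans (size_scale_leq _ _)) //; have [] := top s.
suff : W`_(\sum_i D i) != 0 by apply: contraNneq => ->; rewrite coef0.
have -> : W`_(\sum_i D i) =
    \det (Vandermonde n (\row_i (e i)%:R : 'rV[R]_n)) * \prod_i lead_coef (p i).
  rewrite WE coef_sum -det_tr /determinant mulr_suml; apply: eq_bigr => s _.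
  rewrite sgnE coefZ (top s).2 -mulrA -big_split; congr (_ * _).
  apply: eq_bigr => i _; rewrite (twist_deriv_top _ _ (sp i)).2 !mxE.
  by rewrite lead_coefE.
rewrite mulf_neq0 //; last by apply/prodf_neq0 => i _; rewrite lead_coef_eq0.
rewrite det_Vandermonde; apply/prodf_neq0 => i _; apply/prodf_neq0 => j ij.
rewrite !mxE subr_eq0 eqr_nat; apply: contraTneq ij => /e_inj ->.
by rewrite ltnn.
Qed.

Lemma dvdXn_deriv m (p : {poly R}) : 'X^(m.+1) %| p -> 'X^m %| p^`().
Proof.
move=> /dvdXnP h; apply/dvdXnP => i im.
by rewrite coef_deriv h // mul0rn.
Qed.

(** With z = a + log(1+w), the operator (1+w) d/dw is d/dz, which acts on p_i(z) e^(e_i z) as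
    [twist_deriv]. For the truncated logarithm u this holds up to a multiple of (1 + X) u' - 1,
    hence of X^T; one order of vanishing is lost. *)
Lemma twist_deriv_comp T m n (e : 'I_n -> nat) (p : 'I_n -> {poly R})
    (c : 'I_n -> R) (a : R) :
  (m <= T)%N ->
  'X^(m.+1) %| \sum_i c i *: ((p i \Po (a%:P + log1p_poly R T.+1)) * (1 + 'X) ^+ e i) ->
  'X^m %| \sum_i c i *:
     ((twist_deriv (e i) (p i) \Po (a%:P + log1p_poly R T.+1)) * (1 + 'X) ^+ e i).
Proof.
set u := _ + log1p_poly _ _ => mT /dvdXn_deriv; rewrite raddf_sum /= => hF.
set G := \sum_i _; set F' := \sum_i _ in hF.
have uE : u^`() = (log1p_poly R T.+1)^`() by rewrite derivD derivC add0r.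
have dX : (1 + 'X : {poly R})^`() = 1 by rewrite derivD derivC derivX add0r.
have -> : G = (1 + 'X) * F' -
    (\sum_i c i *: (((p i)^`() \Po u) * (1 + 'X) ^+ e i)) * ((1 + 'X) * u^`() - 1).
  rewrite /G /F' mulr_sumr mulr_suml -sumrB; apply: eq_bigr => i _.
  rewrite derivZ derivM deriv_exp deriv_comp dX mul1r.
  rewrite /twist_deriv comp_polyD comp_polyZ -!mul_polyC.
  case: (e i) => [|k]; first by rewrite mulr0n !expr0 polyC0; ring.
  have kE : (k.+1%:R)%:P = k.+1%:R :> {poly R} by rewrite polyCMn.
  by rewrite kE /= -[(1 + 'X) ^+ k *+ _]mulr_natr exprS; ring.
apply: dvdp_sub; apply: dvdp_mull => //; rewrite uE.
by apply: dvdp_trans (deriv_log1p_poly _ T); apply: dvdp_exp2l.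
Qed.

(** The substitution a + log(1+w) has derivative 1 at w = 0, so it carries the order of W at a to
    the same order at 0. *)
Lemma dvdp_comp_log1p T m (W : {poly R}) (a : R) : (1 < T)%N -> W != 0 ->
  'X^m %| W \Po (a%:P + log1p_poly R T) -> ('X - a%:P) ^+ m %| W.
Proof.
move=> T1 W0; have [k [q]] := multiplicity_XsubC W a; rewrite W0 /= => qa ->.
set l := log1p_poly R T; have [h lE] : exists h, l = h * 'X.
  by have /dvdpP[h hE] := dvdX_log1p_poly R T; exists h.
have h0 : h.[0] = 1.
  have := congr1 (fun p : {poly R} => p`_1) lE; rewrite coefMX /= -horner_coef0 => <-.
  by rewrite coef_poly T1 expr0 divr1.
have [mk _|km] := leqP m k; first by rewrite dvdp_mull // dvdp_exp2l.
rewrite rmorphM rmorphXn /= comp_polyB comp_polyX comp_polyC.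
have -> : (a%:P + l) - a%:P = l by rewrite addrC addKr.
rewrite lE exprMn mulrA -(subnK (ltnW km)) exprD dvdp_mul2r ?expf_neq0 ?polyX_eq0 //.
have -> : (m - k = (m - k).-1.+1)%N by lia.
rewrite exprS => /(dvdp_trans (dvdp_mulr _ (dvdpp _))).
have XE (r : {poly R}) : ('X %| r) = root r 0 by rewrite -dvdp_XsubCl polyC0 subr0.
rewrite XE rootM /root horner_exp horner_comp hornerD hornerC.
by rewrite hornerM hornerX mulr0 addr0 h0 expr1n oner_eq0 orbF => /(negP qa).
Qed.

(* By Cramer's rule the order of vanishing T at the point s x passes, up to n, *)
(* to the Wronskian-like polynomial \det (twist_mx e p).                       *)
Lemma zero_estimate (x : R) n T S (e : 'I_n -> nat) (p : 'I_n -> {poly R})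
    (c : nat -> 'I_n -> R) :
  x != 0 -> (0 < n < T)%N -> injective e -> (forall i, p i != 0) ->
  (forall s i, c s i != 0) ->
  (forall s, (s < S)%N -> 'X^T %|
     \sum_i c s i *: ((p i \Po ((s%:R * x)%:P + log1p_poly R T)) * (1 + 'X) ^+ e i)) ->
  (S * (T - n).+1 <= \sum_i (size (p i)).-1)%N.
Proof.
move=> x0 /andP[n0 nT] e_inj p0 c0 H.
have [] := det_twist_mx e_inj p0; set A := twist_mx e p; set W := \det A => W0 sW.
have dvdW s : (s < S)%N -> ('X - (s%:R * x)%:P) ^+ (T - n).+1 %| W.
  move=> sS; set a := s%:R * x; set u := a%:P + log1p_poly R T.
  apply: (@dvdp_comp_log1p T) => //; first by lia.
  have Fk k : (k <= n)%N -> 'X^(T - k) %|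
      \sum_i c s i *: ((iter k (twist_deriv (e i)) (p i) \Po u) * (1 + 'X) ^+ e i).
    elim: k => [|k IH] kn; first by rewrite subn0; apply: H.
    have IH' := IH (ltnW kn); move: IH'; rewrite /u.
    have -> : T = T.-1.+1 by lia.
    have -> : (T.-1.+1 - k = (T.-1 - k).+1)%N by lia.
    have -> : (T.-1.+1 - k.+1 = T.-1 - k)%N by lia.
    by apply: twist_deriv_comp; lia.
  pose i0 := Ordinal n0.
  (* The cofactors of column [i0] eliminate all terms except the one of index [i0], which becomes a
     nonzero constant times W at u, times a power of 1 + X prime to X. *)
  have : 'X^((T - n).+1) %| \sum_k (cofactor A k i0 \Po u) *
     \sum_i c s i *: ((A k i \Po u) * (1 + 'X) ^+ e i).
    apply: (big_ind (fun q => 'X^((T - n).+1) %| q)) => [||k _].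
    - exact: dvdp0.
    - by move=> ? ?; apply: dvdp_add.
    apply: dvdp_mull; under eq_bigr do rewrite mxE.
    apply: dvdp_trans (Fk k (ltnW (ltn_ord k))); apply: dvdp_exp2l.
    by have := ltn_ord k; lia.
  have -> : \sum_k (cofactor A k i0 \Po u) *
     (\sum_i c s i *: ((A k i \Po u) * (1 + 'X) ^+ e i)) =
     c s i0 *: ((W \Po u) * (1 + 'X) ^+ e i0).
    under eq_bigr do rewrite mulr_sumr.
    rewrite exchange_big /=.
    have E i : \sum_k (cofactor A k i0 \Po u) * (c s i *: ((A k i \Po u) * (1 + 'X)
      ^+ e i)) =
       c s i *: (((W *+ (i0 == i)) \Po u) * (1 + 'X) ^+ e i).
      have -> : W *+ (i0 == i) = \sum_k cofactor A k i0 * A k i.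
        have /matrixP/(_ i0 i) := mul_adj_mx A; rewrite !mxE => <-.
        by apply: eq_bigr => k _; rewrite mxE.
      rewrite raddf_sum /= mulr_suml scaler_sumr; apply: eq_bigr => k _.
      by rewrite -scalerAr mulrA [in RHS]comp_polyM.
    under eq_bigr do rewrite E.
    rewrite (bigD1 i0) // eqxx mulr1n big1 => [|i /negPf ii0].
      exact: addr0.
    by rewrite eq_sym ii0 mulr0n comp_poly0 mul0r scaler0.
  rewrite dvdpZr // Gauss_dvdpl //.
  by apply: coprimep_expl; apply: coprimep_expr;
    rewrite coprimep_sym coprimepX /root !hornerE oner_eq0.
set P := fun s : nat => ('X - (s%:R * x)%:P) ^+ (T - n).+1.
(* The points s x are distinct because x is not 0, so the powers are pairwise coprime and their
   product divides W; the conclusion compares degrees. *)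
suff dvdP k : (k <= S)%N -> \prod_(s < k) P s %| W.
  have /(dvdp_leq W0) := dvdP S (leqnn S).
  have -> : size (\prod_(s < S) P s)%R = (S * (T - n).+1).+1.
    elim: (S) => [|k IH]; first by rewrite big_ord0 size_poly1.
    rewrite big_ord_recr /= size_Mmonic ?monic_exp ?monicXsubC //; last first.
      by rewrite -size_poly_eq0 IH.
    by rewrite IH size_exp_XsubC mulSn; lia.
  by move=> /leq_trans /(_ sW).
elim: k => [|k IH] kS; first by rewrite big_ord0 dvd1p.
rewrite big_ord_recr /= Gauss_dvdp ?IH ?dvdW ?(ltnW kS) //.
elim/big_ind: _ => [|p1 p2 h1 h2|s _].
- exact: coprime1p.
- by rewrite coprimepMl h1.
apply: coprimep_expl; apply: coprimep_expr; rewrite coprimep_XsubC.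
rewrite /root !hornerE subr_eq0; apply/negP => /eqP /(mulIf x0) /eqP.
by rewrite eqr_nat => /eqP ks; have := ltn_ord s; rewrite -ks ltnn.
Qed.

End ZeroEstimate.

(** * Determinants and resultants *)

Section DeterminantBounds.
Variable R : realFieldType.

(** The right side expands into a sum over all maps from rows to columns, and permutations are among
    them. *)
Lemma sum_perm_prod_le n (A : 'I_n -> 'I_n -> R) : (forall i j, 0 <= A i j) ->
  \sum_(s : 'S_n) \prod_i A i (s i) <= \prod_i \sum_j A i j.
Proof.
move=> A0; rewrite bigA_distr_bigA /=.
pose g (s : 'S_n) : {ffun 'I_n -> 'I_n} := [ffun i => s i].
have g_inj : injective g.
  by move=> s t /ffunP st; apply/permP => i; have := st i; rewrite !ffunE.
have -> : \sum_(s : 'S_n) \prod_i A i (s i) =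
    \sum_(f in [set g s | s : 'S_n]) \prod_i A i (f i).
  rewrite big_imset /= => [|s t _ _ /g_inj//].
  by apply: eq_bigr => s _; apply: eq_bigr => i _; rewrite ffunE.
rewrite [leRHS](bigID (mem [set g s | s : 'S_n])) /= lerDl.
by apply: sumr_ge0 => f _; apply: prodr_ge0.
Qed.

(** Values below N are taken at most once, so for each k < N at most k + 1 indices have a value <=
    k, and at least N - k - 1 exceed k. Summing over k gives 0 + 1 + ... + (N-1). *)
Lemma sum_ge_binomial N (f : 'I_N -> 'I_N.+1) :
  (forall i j, (f i < N)%N -> f i = f j -> i = j) ->
  ('C(N, 2) <= \sum_i f i)%N.
Proof.
move=> f_inj.
have fE i : f i = (\sum_(k < N) (k < f i))%N :> nat.
  have fN := ltn_ord (f i).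
  suff -> n : (\sum_(k < n) (k < f i))%N = minn n (f i) by lia.
  elim: n => [|n IH]; first by rewrite big_ord0 min0n.
  by rewrite big_ord_recr /= IH; lia.
under eq_bigr => i _ do rewrite fE.
rewrite exchange_big /= -triangular_sum big_mkord (reindex_inj rev_ord_inj) /=.
apply: leq_sum => k _.
have -> : (\sum_(i < N) (k < f i) = #|[set i | (k < f i)%N]|)%N.
  by rewrite -sum1_card [RHS]big_mkcond; apply: eq_bigr => i _; rewrite inE;
    case: (_ < _)%N.
have := cardsC [set i | (k < f i)%N]; rewrite card_ord.
suff : (#|~: [set i | (k < f i)%N]| <= k.+1)%N by lia.
pose g (i : 'I_N) : 'I_k.+1 := inord (f i).
rewrite -[X in (_ <= X)%N](card_ord k.+1) -(@card_in_imset _ _ g);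
  first exact: max_card.
have gE i : i \in ~: [set i | (k < f i)%N] -> g i = f i :> nat /\ (f i < N)%N.
  rewrite !inE -leqNgt => fk; split; last exact: leq_ltn_trans (ltn_ord k).
  by rewrite inordK // ltnS.
move=> i j /gE[gi fiN] /gE[gj _] /(congr1 val); rewrite /= gi gj => /val_inj.
exact: f_inj.
Qed.

(* The index n < N numbers the powers, n = N stands for the remainder of the   *)
(* expansion of a row, which is as small as the first omitted power.           *)
Lemma interpolation_det_le N (M : 'M[R]_N) (rho : R) (c : 'I_N -> 'I_N.+1 -> R)
    (v : 'I_N -> 'I_N.+1 -> 'I_N -> R) (B : 'I_N -> 'I_N.+1 -> R) :
  0 < rho <= 1 ->
  (forall l m, M l m = \sum_n c l n * v l n m) ->
  (forall l l' (n : 'I_N.+1) m, (n < N)%N -> v l n m = v l' n m) ->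
  (forall l (n : 'I_N.+1) m, `|c l n * v l n m| <= rho ^+ n * B l n) ->
  `|\det M| <= N`!%:R * rho ^+ 'C(N, 2) * \prod_l \sum_n B l n.
Proof.
move=> /andP[r0 r1] ME vE cB.
have B0 l n : 0 <= B l n.
  rewrite -(pmulr_rge0 _ (exprn_gt0 n r0)).
  have [N0|N0] := posnP N; first by move: (ltn_ord l); rewrite {2}N0.
  by apply: le_trans (cB l n (Ordinal N0)).
pose Mf (f : {ffun 'I_N -> 'I_N.+1}) : 'M[R]_N := \matrix_(l, m) v l (f l) m.
(* Multilinearity: f chooses for each row the power, or the remainder, that is used. *)
have -> : \det M = \sum_(f : {ffun 'I_N -> 'I_N.+1}) (\prod_l c l (f l)) * \det (Mf f).
  rewrite /determinant; under [RHS]eq_bigr do rewrite mulr_sumr.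
  rewrite [RHS]exchange_big /=; apply: eq_bigr => s _.
  under eq_bigr do rewrite ME.
  rewrite bigA_distr_bigA /= mulr_sumr; apply: eq_bigr => f _.
  rewrite mulrCA -big_split /=; congr (_ * _); apply: eq_bigr => l _.
  by rewrite mxE.
apply: le_trans (ler_norm_sum _ _ _) _.
rewrite bigA_distr_bigA /= mulr_sumr; apply: ler_sum => f _.
(* Two rows that choose the same power below N are equal, so the determinant vanishes; the other
   choices satisfy the hypothesis of [sum_ge_binomial]. *)
have [/existsP[i /existsP[j /and3P[fi /eqP fij ij]]]|fN] :=
  boolP [exists i, exists j, [&& (f i < N)%N, f i == f j & i != j]].
  rewrite (determinant_alternate ij) ?mulr0 ?normr0; last first.
    by move=> m; rewrite !mxE -fij; apply: vE.
  rewrite mulr_ge0 ?prodr_ge0 // mulr_ge0 // exprn_ge0 // ltW //.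
rewrite /determinant mulr_sumr; apply: le_trans (ler_norm_sum _ _ _) _.
rewrite -card_Sn -sum1_card natr_sum !mulr_suml; apply: ler_sum => s _.
rewrite mul1r mulrCA -big_split normrM normrX normrN normr1 expr1n mul1r.
rewrite normr_prod /=.
apply: (@le_trans _ _ (\prod_l (rho ^+ f l * B l (f l)))).
  by apply: ler_prod => l _; rewrite normr_ge0 mxE cB.
rewrite big_split /= ler_wpM2r ?prodr_ge0 //.
rewrite -expr_sum; apply: ler_wiXn2l; rewrite ?(ltW r0) //.
apply: sum_ge_binomial => i j fi fij; apply/eqP; apply: contraNT fN => ij.
by apply/existsP; exists i; apply/existsP; exists j; rewrite fi ij fij eqxx.
Qed.
End DeterminantBounds.

Section Resultant.
Variable R : realType.
Implicit Types P Q : {poly int}.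

Local Notation len P := ((zpoly_length P)%:~R : R).

Lemma zpoly_length_ge0 P : 0 <= zpoly_length P.
Proof. exact: sumr_ge0. Qed.

Lemma zpoly_length_ge1 P : P != 0 -> 1 <= zpoly_length P.
Proof.
move=> P0; have sP : (0 < size P)%N by rewrite size_poly_gt0.
have lP : (((size P).-1) < size P)%N by rewrite ltn_predL.
rewrite /zpoly_length (bigD1 (Ordinal lP)) //=.
have : 1 <= `|P`_(size P).-1|.
  by rewrite -gtz0_ge1 normr_gt0 -lead_coefE lead_coef_eq0.
by move=> /le_trans; apply; rewrite lerDl sumr_ge0.
Qed.

Lemma sum_norm_coef_le P n : \sum_(i < n) `|P`_i| <= zpoly_length P.
Proof.
rewrite /zpoly_length; have [nP|Pn] := leqP n (size P).
  rewrite (big_ord_widen _ (fun i => `|P`_i|) nP) big_mkcond.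
  by apply: ler_sum => i _; case: ifP.
rewrite (big_ord_widen _ (fun i => `|P`_i|) (ltnW Pn)) [leRHS]big_mkcond.
apply: ler_sum => i _; case: ltnP => // iP.
by rewrite nth_default // normr0.
Qed.

(** The cofactor is the determinant in which row i is replaced by the j-th unit vector, a row of sum
    1. *)
Lemma norm_cofactor_le n (A : 'M[R]_n) i j :
  `|cofactor A i j| <= \prod_(k | k != i) \sum_l `|A k l|.
Proof.
pose B k l := if k == i then (l == j)%:R else `|A k l|.
have B0 k l : 0 <= B k l by rewrite /B; case: ifP => // _; case: eqP.
rewrite expand_cofactor; apply: le_trans (ler_norm_sum _ _ _) _.
apply: le_trans (_ : \sum_(s : 'S_n) \prod_k B k (s k) <= _); last first.
  apply: le_trans (sum_perm_prod_le B0) _.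
  rewrite (bigD1 i) //= {1}/B eqxx -natr_sum.
  have -> : (\sum_(l < n) (l == j) = 1)%N.
    rewrite (bigD1 j) //= eqxx big1 // => l /negPf ->.
    by [].
  rewrite mul1r; apply: ler_prod => k ki; rewrite sumr_ge0 //=.
  by rewrite /B (negPf ki).
rewrite big_mkcond /=; apply: ler_sum => s _; case: ifP => [/eqP sij|_]; last first.
  by apply: prodr_ge0.
rewrite normrM normrX normrN normr1 expr1n mul1r normr_prod.
rewrite [leRHS](bigD1 i) //= {1}/B eqxx sij eqxx mul1r.
rewrite (eq_bigl (fun k => k != i)) => [|k]; last by rewrite eq_sym.
by apply: ler_prod => k ki; rewrite /B (negPf (ki : k != i)) normr_ge0 lexx.
Qed.

Lemma sylvester_row P m k (x : R) : (k + (size P).-1 < m)%N -> P != 0 ->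
  \sum_(j < m) (P`_(j - k) *+ (k <= j))%:~R * x ^+ j = x ^+ k * zpoly_eval P x.
Proof.
move=> km P0.
have -> : x ^+ k * zpoly_eval P x = (map_poly intr (P * 'X^k)).[x].
  by rewrite rmorphM /= map_polyXn hornerM hornerXn mulrC.
rewrite (@horner_coef_wide _ m).
  apply: eq_bigr => j _; rewrite coef_map coefMXn; congr (_%:~R * _).
  by case: leqP.
apply: (leq_trans (size_poly _ _)); apply: leq_trans (size_polyMleq _ _) _.
move: P0; rewrite size_polyXn -size_poly_gt0.
have h n : (k + n.-1 < m -> 0 < n -> (n + k.+1).-1 <= m)%N by lia.
exact: h km.
Qed.

Lemma sylvester_row_length P m k :
  \sum_(j < m) `|P`_(j - k) *+ (k <= j)| <= zpoly_length P.
Proof.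
have [mk|km] := leqP m k.
  rewrite big1 ?zpoly_length_ge0 // => j _.
  by rewrite leqNgt (leq_trans (ltn_ord j) mk) mulr0n normr0.
rewrite -(big_mkord xpredT (fun j => `|P`_(j - k) *+ (k <= j)|)).
rewrite (@big_cat_nat _ _ _ k) ?(ltnW km) //= big1_seq ?add0r => [|j]; last first.
  by rewrite mem_index_iota /= => jk; rewrite leqNgt jk mulr0n normr0.
rewrite -{1}[k]add0n big_addn big_mkord.
under eq_bigr do rewrite addnK leq_addl mulr1n.
exact: sum_norm_coef_le.
Qed.

(** The resultant is a nonzero integer, hence at least 1 in absolute value. Adding to the first
    column of the Sylvester matrix the other columns times powers of x turns its entries into x^k
    P(x) and x^k Q(x); expanding along this column, each cofactor lacks one row, of P or of Q. *)
Lemma coprimep_eval_ge P Q m n (x : R) :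
  coprimep P Q -> size P = m.+1 -> size Q = n.+1 -> (0 < m)%N -> `|x| <= 1 ->
  1 <= n%:R * `|zpoly_eval P x| * len P ^+ n.-1 * len Q ^+ m +
       m%:R * `|zpoly_eval Q x| * len P ^+ n * len Q ^+ m.-1.
Proof.
move=> cPQ sP sQ m0 x1.
have nz (F : {poly int}) k : size F = k.+1 -> F != 0 by rewrite -size_poly_eq0 => ->.
have mE : (size P).-1 = m by rewrite sP.
have nE : (size Q).-1 = n by rewrite sQ.
subst m n.
set m := (size P).-1 in sP m0 *; set n := (size Q).-1 in sQ *.
set S : 'M[R]_(n + m) := map_mx intr (Sylvester_mx P Q).
have detS : 1 <= `|\det S|.
  rewrite det_map_mx -intr_norm -[1]/(1%:~R) ler_int -gtz0_ge1 normr_gt0.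
  by rewrite resultant_eq0; move: cPQ; rewrite coprimep_def => /eqP ->.
have K0 : (0 < n + m)%N by rewrite addn_gt0 m0 orbT.
pose j0 := Ordinal K0.
(* Only the column of x^0 survives in the sum: the cofactors of column [j0] are orthogonal to the
   other columns. *)
have key : \det S = \sum_i cofactor S i j0 * \sum_j S i j * x ^+ j.
  have /matrixP/(_ j0 j0) h := mul_adj_mx S.
  under [RHS]eq_bigr do rewrite mulr_sumr.
  rewrite exchange_big /= (bigD1 j0) //= expr0.
  rewrite [X in _ = _ + X]big1 ?addr0 => [|j jj0].
    move: h; rewrite mxE [RHS]mxE eqxx mulr1n => <-; apply: eq_bigr => i _.
    by rewrite [(\adj S) _ _]mxE mulr1.
  have /matrixP/(_ j0 j) := mul_adj_mx S; rewrite !mxE eq_sym (negPf jj0) => e.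
  rewrite (eq_bigr (fun i => (\adj S) j0 i * S i j * x ^+ j)) => [|i _];
    last by rewrite [in RHS]mxE mulrA.
  by rewrite -mulr_suml e mul0r.
have rowP (k : 'I_n) : \sum_j S (lshift m k) j * x ^+ j = x ^+ k * zpoly_eval P x.
  rewrite -(@sylvester_row P (n + m) k) ?(nz _ _ sP) ?sP ?ltn_add2r //.
  apply: eq_bigr => j _; rewrite mxE Sylvester_mxE.
  by rewrite (unsplitK (inl k)).
have rowQ (k : 'I_m) : \sum_j S (rshift n k) j * x ^+ j = x ^+ k * zpoly_eval Q x.
  rewrite -(@sylvester_row Q (n + m) k) ?(nz _ _ sQ) ?sQ 1?addnC ?ltn_add2l //.
  apply: eq_bigr => j _; rewrite mxE Sylvester_mxE.
  by rewrite (unsplitK (inr k)).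
have lenP (k : 'I_n) : \sum_j `|S (lshift m k) j| <= len P.
  apply: le_trans (_ : (\sum_(j < n + m) `|P`_(j - k) *+ (k <= j)|)%:~R <= _);
    last first.
    by rewrite ler_int sylvester_row_length.
  rewrite rmorph_sum /=; apply: ler_sum => j _.
  by rewrite mxE Sylvester_mxE (unsplitK (inl k)) intr_norm.
have lenQ (k : 'I_m) : \sum_j `|S (rshift n k) j| <= len Q.
  apply: le_trans (_ : (\sum_(j < n + m) `|Q`_(j - k) *+ (k <= j)|)%:~R <= _);
    last first.
    by rewrite ler_int sylvester_row_length.
  rewrite rmorph_sum /=; apply: ler_sum => j _.
  by rewrite mxE Sylvester_mxE (unsplitK (inr k)) intr_norm.
have cofP (k : 'I_n) : `|cofactor S (lshift m k) j0| <= len P ^+ n.-1 * len Q ^+ m.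
  apply: le_trans (norm_cofactor_le _ _ _) _.
  rewrite big_split_ord /=; apply: ler_pM; rewrite ?prodr_ge0 // => *;
    rewrite ?sumr_ge0 //.
    have -> : len P ^+ n.-1 = \prod_(i in predC1 k) len P by rewrite prodr_const
      cardC1 card_ord.
    rewrite (eq_bigl (fun i => i != k)) => [|i];
      last by rewrite (inj_eq (@lshift_inj _ _)).
    by apply: ler_prod => i _; rewrite lenP sumr_ge0.
  have -> : len Q ^+ m = \prod_(i < m) len Q by rewrite prodr_const card_ord.
  rewrite big_mkcond.
  by apply: ler_prod => i _; rewrite eq_rlshift lenQ sumr_ge0.
have cofQ (k : 'I_m) : `|cofactor S (rshift n k) j0| <= len P ^+ n * len Q ^+ m.-1.
  apply: le_trans (norm_cofactor_le _ _ _) _.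
  rewrite big_split_ord /=; apply: ler_pM; rewrite ?prodr_ge0 // => *;
    rewrite ?sumr_ge0 //.
    have -> : len P ^+ n = \prod_(i < n) len P by rewrite prodr_const card_ord.
    rewrite big_mkcond.
    by apply: ler_prod => i _; rewrite eq_lrshift lenP sumr_ge0.
  have -> : len Q ^+ m.-1 = \prod_(i in predC1 k) len Q by rewrite prodr_const cardC1
    card_ord.
  rewrite (eq_bigl (fun i => i != k)) => [|i];
    last by rewrite (inj_eq (@rshift_inj _ _)).
  by apply: ler_prod => i _; rewrite lenQ sumr_ge0.
have xk k : `|x ^+ k| <= 1 by rewrite normrX exprn_ile1.
have sumE k (a : R) : k%:R * a = \sum_(i < k) a by rewrite sumr_const card_ord
  mulr_natl.
apply: le_trans detS _; rewrite key big_split_ord /= -!mulrA !sumE.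
apply: le_trans (ler_normD _ _) _; apply: lerD.
  apply: le_trans (ler_norm_sum _ _ _) _; apply: ler_sum => k _.
  rewrite rowP normrM [`|x ^+ _ * _|]normrM mulrC -mulrA.
  by apply: le_trans (ler_piMl _ (xk _)) _; rewrite ?mulr_ge0 ?ler_wpM2l ?cofP.
apply: le_trans (ler_norm_sum _ _ _) _; apply: ler_sum => k _.
rewrite rowQ normrM [`|x ^+ _ * _|]normrM mulrC -mulrA.
by apply: le_trans (ler_piMl _ (xk _)) _; rewrite ?mulr_ge0 ?ler_wpM2l ?cofQ.
Qed.

End Resultant.

(** * Lengths of integer polynomials *)

Section Length.
Implicit Types P Q : {poly int}.

Definition abs_poly P : {poly int} := \poly_(i < size P) `|P`_i|.

Lemma coef_abs_poly P i : (abs_poly P)`_i = `|P`_i|.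
Proof. by rewrite coef_poly; case: ltnP => // Pi; rewrite nth_default ?normr0. Qed.

Lemma majorant_abs_poly P : majorant P (abs_poly P).
Proof. by move=> i; rewrite coef_abs_poly. Qed.

Lemma zpoly_lengthE P : zpoly_length P = (abs_poly P).[1].
Proof.
rewrite horner_poly /zpoly_length; apply: eq_bigr => i _.
by rewrite expr1n mulr1.
Qed.

Lemma zpoly_length_majorant P Q : majorant P Q -> zpoly_length P <= Q.[1].
Proof.
move=> PQ; rewrite (@horner_coef_wide _ (maxn (size P) (size Q))) ?leq_maxr //.
rewrite /zpoly_length (big_ord_widen _ (fun i => `|P`_i|) (leq_maxl _ (size Q))).
rewrite big_mkcond; apply: ler_sum => i _; rewrite expr1n mulr1.
by case: ifP => // _; apply: majorant_ge0 PQ _.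
Qed.

Lemma zpoly_lengthD P Q : zpoly_length (P + Q) <= zpoly_length P + zpoly_length Q.
Proof.
rewrite !zpoly_lengthE -hornerD -zpoly_lengthE; apply: zpoly_length_majorant.
by apply: majorantD; apply: majorant_abs_poly.
Qed.

Lemma zpoly_lengthM P Q : zpoly_length (P * Q) <= zpoly_length P * zpoly_length Q.
Proof.
rewrite !zpoly_lengthE -hornerM -zpoly_lengthE; apply: zpoly_length_majorant.
by apply: majorantM; apply: majorant_abs_poly.
Qed.

Lemma zpoly_length_monomial c n : zpoly_length (c *: 'X^n) <= `|c|.
Proof.
have -> : `|c| = (`|c| *: 'X^n).[1] by rewrite hornerZ hornerXn expr1n mulr1.
apply: zpoly_length_majorant => i; rewrite !coefZ coefXn normrM.
by case: eqP; rewrite ?normr1 ?normr0.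
Qed.

Lemma zpoly_length_sum (I : finType) (F : I -> {poly int}) :
  zpoly_length (\sum_i F i) <= \sum_i zpoly_length (F i).
Proof.
elim/big_ind2: _ => // [|p m q n hp hq];
  first by rewrite /zpoly_length size_poly0 big_ord0.
by apply: le_trans (zpoly_lengthD _ _) _; apply: lerD.
Qed.

Lemma zpoly_length_prod (I : finType) (F : I -> {poly int}) :
  zpoly_length (\prod_i F i) <= \prod_i zpoly_length (F i).
Proof.
elim/big_ind2: _ => // [|p m q n hp hq].
  by rewrite /zpoly_length size_poly1 big_ord1 coef1.
apply: le_trans (zpoly_lengthM _ _) _.
by apply: ler_pM => //; apply: sumr_ge0.
Qed.

Lemma zpoly_length_det n (A : 'M[{poly int}]_n) (R : realDomainType) (b : 'I_n -> R) :
  (forall i j, (zpoly_length (A i j))%:~R <= b i) ->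
  (zpoly_length (\det A))%:~R <= n`!%:R * \prod_i b i.
Proof.
move=> h.
apply: (@le_trans _ _ (\sum_(s : 'S_n) (zpoly_length ((-1) ^+ s * \prod_i A i (s
  i)))%:~R)).
  by rewrite -rmorph_sum ler_int zpoly_length_sum.
rewrite -card_Sn -sum1_card natr_sum mulr_suml; apply: ler_sum => s _.
rewrite mul1r.
have -> : zpoly_length ((-1) ^+ s * \prod_i A i (s i)) = zpoly_length (\prod_i A i (s
  i)).
  case: (odd_perm s); rewrite ?expr0 ?mul1r // expr1 mulN1r /zpoly_length size_polyN.
  by apply: eq_bigr => i _; rewrite coefN normrN.
apply: le_trans (_ : (\prod_i zpoly_length (A i (s i)))%:~R <= _).
  by rewrite ler_int zpoly_length_prod.
rewrite rmorph_prod; apply: ler_prod => i _; rewrite h andbT ler0z.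
exact: zpoly_length_ge0.
Qed.

End Length.

(** * The remainder of the exponential series *)

Section ExpTail.
Variable R : realType.

Definition exp_sum (x : R) n := \sum_(p < n) (x ^+ p / p`!%:R).

Lemma exp_sumE (x : R) n : exp_sum x n = series (exp_coeff x) n.
Proof. by rewrite /series /= big_mkord. Qed.

Lemma exp_sum_le (x : R) n : 0 <= x -> exp_sum x n <= expR x.
Proof.
move=> x0; rewrite exp_sumE; apply: nondecreasing_cvgn_le.
  apply: nondecreasing_series => k _ _.
  by rewrite /exp_coeff /= divr_ge0 ?exprn_ge0.
exact: is_cvg_series_exp_coeff.
Qed.

(** Rankin's trick: a term of index p >= k is at most E^(-k) times the same term of the series of
    exp(xE). *)
Lemma exp_sum_tail (x E : R) k : 0 <= x -> 1 <= E ->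
  `|expR x - exp_sum x k| <= (E ^+ k)^-1 * expR (x * E).
Proof.
move=> x0 E1; rewrite ger0_norm ?subr_ge0 ?exp_sum_le // lerBlDl.
have E0 : 0 < E by apply: lt_le_trans E1.
apply: limr_le; first exact: is_cvg_series_exp_coeff.
near=> n; rewrite -exp_sumE.
have kn : (k <= n)%N by near: n; exists k.
rewrite /exp_sum -(big_mkord xpredT (fun p => x ^+ p / p`!%:R)) (@big_cat_nat _ _ _
  k) //=.
rewrite big_mkord lerD2l mulrC ler_pdivlMr ?exprn_gt0 //.
have xE0 : 0 <= x * E by rewrite mulr_ge0 // ltW.
apply: le_trans (exp_sum_le n xE0).
rewrite /exp_sum -(big_mkord xpredT (fun p => (x * E) ^+ p / p`!%:R)).
rewrite [leRHS](@big_cat_nat _ _ _ k) //= -[leLHS]add0r; apply: lerD.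
  by apply: sumr_ge0 => p _; rewrite divr_ge0 ?exprn_ge0.
rewrite mulr_suml !big_nat; apply: ler_sum => p /andP[kp _].
rewrite mulrAC ler_wpM2r ?invr_ge0 // exprMn ler_wpM2l ?exprn_ge0 //.
exact: ler_weXn2l.
Unshelve. all: by end_near. Qed.

End ExpTail.

(** * The interpolation matrix *)

Section Entries.
Variable R : realType.

(** The factor e^(jz) keeps its true value 2^(sj) at z = s log 2; only the polynomial factor depends
    on x. This makes the entry a polynomial in x with rational coefficients. *)
Definition entry T s j i t (x : R) : R :=
  2 ^+ (s * j) * (((s%:R * x)%:P + log1p_poly R T) ^+ i * (1 + 'X) ^+ j)`_t.

Definition log_coef T j k t : R := (log1p_poly R T ^+ k * (1 + 'X) ^+ j)`_t.

Lemma entryE T s j i t x : entry T s j i t x =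
  \sum_(k < i.+1) 2 ^+ (s * j) * (s%:R * x) ^+ (i - k) *+ 'C(i, k) * log_coef T j k t.
Proof.
rewrite /entry [(_ + log1p_poly R T) ^+ i]exprDn mulr_suml coef_sum mulr_sumr;
  apply: eq_bigr => k _.
rewrite -polyC_exp [_ *+ _ * (1 + 'X) ^+ j]mulrnAl coefMn -mulrA coefCM.
by rewrite [LHS]mulrnAr [RHS]mulrnAl mulrA.
Qed.

Lemma norm_log_coef_le T j k t : `|log_coef T j k t| <= 2 ^+ j * 2 ^+ t.
Proof.
have maj : majorant (log1p_poly R T ^+ k * (1 + 'X) ^+ j)
                    (log1p_majorant R T ^+ k * (1 + 'X) ^+ j).
  by apply: majorantM; apply: majorantX; [apply: majorant_log1p|apply: majorant_1DX].
apply: le_trans (majorant_coef t maj) _; rewrite mulrC ler_wpM2r ?exprn_ge0 //.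
rewrite hornerM !horner_exp hornerD hornerC hornerX.
have m0 : 0 <= (log1p_majorant R T).[1 / 2].
  by rewrite horner_poly sumr_ge0 // => a _; rewrite mulr_ge0 ?invr_ge0 ?exprn_ge0.
have h0 : 0 <= 1 + 1 / 2 :> R by lra.
rewrite -[leRHS]mul1r ler_pM ?exprn_ge0 ?exprn_ile1 ?log1p_majorant_half //.
by apply: lerXn2r; rewrite ?nnegrE //; lra.
Qed.

Lemma sum_norm_entry_le T s j i t :
  \sum_(k < i.+1) 2 ^+ (s * j) * s%:R ^+ (i - k) *+ 'C(i, k) * `|log_coef T j k t|
  <= s.+1%:R ^+ i * 2 ^+ (s.+1 * j) * 2 ^+ t.
Proof.
have -> : s.+1%:R ^+ i * 2 ^+ (s.+1 * j) * 2 ^+ t =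
    \sum_(k < i.+1) (s%:R ^+ (i - k) *+ 'C(i, k)) * (2 ^+ (s * j) * (2 ^+ j * 2 ^+
      t)) :> R.
  rewrite -mulr_suml -natr1 exprDn mulSn exprD -!mulrA; congr (_ * _);
    last by rewrite mulrCA.
  by apply: eq_bigr => k _; rewrite expr1n mulr1.
apply: ler_sum => k _;
  rewrite -mulrnAr -mulrA mulrCA ler_wpM2l ?mulrn_wge0 ?exprn_ge0 //.
by rewrite ler_wpM2l ?exprn_ge0 // norm_log_coef_le.
Qed.

Lemma entry_lip T s j i t (x y : R) : `|x| <= 1 -> `|y| <= 1 ->
  `|entry T s j i t x - entry T s j i t y| <=
  i%:R * `|x - y| * (s.+1%:R ^+ i * 2 ^+ (s.+1 * j) * 2 ^+ t).
Proof.
move=> x1 y1.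
have lip n : `|x ^+ n - y ^+ n| <= n%:R * `|x - y|.
  rewrite subrXX normrM mulrC ler_wpM2r //.
  apply: le_trans (ler_norm_sum _ _ _) _.
  rewrite -[n in leRHS]card_ord -sumr_const; apply: ler_sum => k _.
  by rewrite normrM !normrX mulr_ile1 ?exprn_ge0 // exprn_ile1.
apply: (@le_trans _ _ (\sum_(k < i.+1) (i%:R * `|x - y|) *
   (2 ^+ (s * j) * s%:R ^+ (i - k) *+ 'C(i, k) * `|log_coef T j k t|))); last first.
  by rewrite -mulr_sumr ler_wpM2l ?mulr_ge0 // sum_norm_entry_le.
rewrite !entryE -sumrB; apply: le_trans (ler_norm_sum _ _ _) _.
apply: ler_sum => k _; rewrite !exprMn.
set w := _ *+ _ * `|_|; set q := log_coef _ _ _ _ in w *.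
have -> : 2 ^+ (s * j) * (s%:R ^+ (i - k) * x ^+ (i - k)) *+ 'C(i, k) * q -
    2 ^+ (s * j) * (s%:R ^+ (i - k) * y ^+ (i - k)) *+ 'C(i, k) * q =
    (2 ^+ (s * j) * s%:R ^+ (i - k) *+ 'C(i, k) * q) * (x ^+ (i - k) - y ^+ (i - k))
      by ring.
have w0 : 0 <= 2 ^+ (s * j) * s%:R ^+ (i - k) *+ 'C(i, k) :> R.
  by rewrite mulrn_wge0 // mulr_ge0 ?exprn_ge0.
rewrite !normrM (ger0_norm w0) mulrC ler_wpM2r ?mulr_ge0 //.
by apply: le_trans (lip _) _; rewrite ler_wpM2r // ler_nat leq_subr.
Qed.

Lemma entry_zpoly T L0 s j i t : (t < T)%N -> (i < L0)%N ->
  exists F : {poly int}, [/\ (size F <= i.+1)%N,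
    forall x : R, zpoly_eval F x = (prod_lcm L0 T)%:R * entry T s j i t x &
    (zpoly_length F)%:~R <=
      (prod_lcm L0 T)%:R * (s.+1%:R ^+ i * 2 ^+ (s.+1 * j) * 2 ^+ t) :> R].
Proof.
move=> tT iL; set La := prod_lcm L0 T.
pose z (k : 'I_i.+1) : int := Num.floor (La%:R * log_coef T j k t).
have zE k : (z k)%:~R = La%:R * log_coef T j k t :> R.
  apply: floorK; apply: int_coef_log1p_poly_exp => // s' s1 sk st.
  apply: prod_dvd_prod_lcm => //; have := ltn_ord k; lia.
pose c (k : 'I_i.+1) : int := (2 ^+ (s * j) * s%:R ^+ (i - k) *+ 'C(i, k)) * z k.
exists (\sum_k c k *: 'X^(i - k)); split.
- apply: leq_trans (size_sum _ _ _) _; apply/bigmax_leqP => k _.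
  by rewrite (leq_trans (size_scale_leq _ _)) // size_polyXn; lia.
- move=> x; rewrite /zpoly_eval raddf_sum horner_sum entryE mulr_sumr /=.
  apply: eq_bigr => k _; rewrite map_polyZ /= map_polyXn hornerZ hornerXn.
  rewrite /c rmorphM rmorphMn rmorphM /= !rmorphXn /= !rmorph_nat zE exprMn.
  by ring.
apply: (@le_trans _ _ (\sum_k `|c k|%:~R)).
  rewrite -rmorph_sum ler_int; apply: le_trans (zpoly_length_sum _) _.
  by apply: ler_sum => k _; apply: zpoly_length_monomial.
apply: le_trans (_ : La%:R * \sum_(k < i.+1) 2 ^+ (s * j) * s%:R ^+ (i - k) *+ 'C(i,
  k) * `|log_coef T j k t| <= _).
  rewrite mulr_sumr; apply: ler_sum => k _.
  rewrite intr_norm /c rmorphM rmorphMn rmorphM /= !rmorphXn /= !rmorph_nat zE.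
  rewrite !normrM normrMn normrM !normrX !normr_nat mulrCA //.
by rewrite ler_wpM2l // sum_norm_entry_le.
Qed.

Section Approximation.
Variables (T s j i t : nat) (E : R).
Hypotheses (tT : (t < T)%N) (E1 : 1 <= E).

Let a : R := s%:R * ln 2.
Let l := log1p_poly R T.
Let g := (a%:P + l) ^+ i.
(** The coefficient of w^t in the m-th term of z^i (1+w)^j, after (1+w)^j is expanded as the
    exponential series of j log(1+w). *)
Let b m : R := j%:R ^+ m / m`!%:R * (g * l ^+ m)`_t.

Let ln2_ge0 : 0 <= ln (2 : R). Proof. by apply: ln_ge0; lra. Qed.
Let ln2_le1 : ln (2 : R) <= 1.
Proof. by have := @le_ln1Dx R 1; rewrite -[1 + 1]/(2%:R); apply; lra. Qed.
Let a_ge0 : 0 <= a. Proof. by rewrite mulr_ge0. Qed.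
Let a_le : a + 1 <= s.+1%:R.
Proof. by rewrite -natr1 lerD2r -[leRHS]mulr1 ler_wpM2l. Qed.

Lemma norm_coef_shift_log n m : `|((a%:P + l) ^+ n * l ^+ m)`_t| <= s.+1%:R ^+ n * 2
  ^+ t.
Proof.
have maj : majorant ((a%:P + l) ^+ n * l ^+ m)
    ((a%:P + log1p_majorant R T) ^+ n * log1p_majorant R T ^+ m).
  have ml := @majorant_log1p R T; apply: majorantM; apply: majorantX => //.
  by apply: majorantD => //; apply: majorantC; rewrite ger0_norm.
apply: le_trans (majorant_coef t maj) _; rewrite mulrC ler_wpM2r ?exprn_ge0 //.
have m0 : 0 <= (log1p_majorant R T).[1 / 2].
  by rewrite horner_poly sumr_ge0 // => k _; rewrite mulr_ge0 ?invr_ge0 ?exprn_ge0.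
have m1 := @log1p_majorant_half R T.
rewrite hornerM !horner_exp hornerD hornerC -[leRHS]mulr1.
have am : 0 <= a + (log1p_majorant R T).[1 / 2] by rewrite addr_ge0.
rewrite ler_pM ?exprn_ge0 ?exprn_ile1 //.
by apply: lerXn2r; rewrite ?nnegrE //; apply: le_trans a_le; rewrite lerD2l.
Qed.

Let b_ge m : (T <= m)%N -> b m = 0.
Proof.
move=> Tm; rewrite /b; suff -> : (g * l ^+ m)`_t = 0 by rewrite mulr0.
have lX : 'X^m %| g * l ^+ m.
  by apply: dvdp_mull; apply: dvdp_exp2r; apply: dvdX_log1p_poly.
by move/dvdXnP: lX; apply; lia.
Qed.

Let entry_b : entry T s j i t (ln 2) = expR (j%:R * a) * \sum_(m < T) b m.
Proof.
rewrite /entry -/a -/l -/g; congr (_ * _).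
  rewrite /a mulrA -natrM mulnC expRM_natl lnK // posrE; lra.
have T0 : T = T.-1.+1 by lia.
have /(dvdp_mull g)/dvdXnP/(_ t) := exp_log1p_poly R T.-1 j.
rewrite -T0 -/l mulrBr coefB => /(_ tT) /eqP; rewrite subr_eq0 => /eqP ->.
rewrite mulr_sumr coef_sum; apply: eq_bigr => m _.
by rewrite -scalerAr coefZ.
Qed.

(** Binomial theorem: (j(a+l))^M / M! is the sum of (jl)^m / m! times (ja)^(M-m) / (M-m)!. For fixed
    m the indices M < K leave K - m terms, none if m >= K. *)
Let partial_b K U : (K <= U)%N ->
  \sum_(M < K) (j%:R ^+ M / M`!%:R) * (g * (a%:P + l) ^+ M)`_t =
  \sum_(m < U) b m * exp_sum (j%:R * a) (K - m).
Proof.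
elim: K => [|K IH] KU.
  rewrite big_ord0 big1 // => m _; rewrite sub0n /exp_sum big_ord0 mulr0 //.
rewrite big_ord_recr /= IH ?(ltnW KU) //.
have -> : \sum_(m < U) b m * exp_sum (j%:R * a) (K.+1 - m) =
  \sum_(m < U) b m * exp_sum (j%:R * a) (K - m) +
  \sum_(m < U | (m < K.+1)%N) b m * ((j%:R * a) ^+ (K - m) / (K - m)`!%:R).
  rewrite [X in _ + X]big_mkcond -big_split /=; apply: eq_bigr => m _.
  case: ltnP => Km; last first.
    by rewrite addr0; congr (_ * exp_sum _ _); lia.
  by rewrite subSn // /exp_sum big_ord_recr mulrDr.
congr (_ + _).
rewrite -(big_ord_widen U (fun m => b m * ((j%:R * a) ^+ (K - m) / (K - m)`!%:R))) //.
rewrite exprDn mulr_sumr coef_sum mulr_sumr; apply: eq_bigr => -[m /= mK] _.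
have -> : g * ((a%:P) ^+ (K - m) * l ^+ m *+ 'C(K, m)) =
    (a ^+ (K - m) *+ 'C(K, m)) *: (g * l ^+ m).
  by rewrite -mul_polyC polyCMn -polyC_exp; ring.
rewrite coefZ /b; set q := (g * l ^+ m)`_t.
have /(congr1 (fun n => n%:R : R)) := bin_fact (mK : (m <= K)%N).
rewrite !natrM => <-;
  rewrite [(j%:R * a) ^+ _]exprMn -{1}(subnKC (mK : (m <= K)%N)) exprD.
have f0 n : (n`!%:R : R) != 0 by rewrite pnatr_eq0 -lt0n fact_gt0.
have c0 : 'C(K, m)%:R != 0 :> R by rewrite pnatr_eq0 -lt0n bin_gt0.
rewrite -[a ^+ _ *+ _]mulr_natr; field.
by rewrite !f0 c0.
Qed.

(** The entry at log 2 comes from z^i e^(jz) with z = a + log(1+w), and the sum is its power series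
    in z cut at degree N. Sorted by powers of log(1+w), the error is a combination of tails of
    e^(ja), to which [exp_sum_tail] applies. *)
Lemma entry_approx N : (i <= N)%N ->
  `|entry T s j i t (ln 2) -
    \sum_(n < N | (i <= n)%N) (j%:R ^+ (n - i) / (n - i)`!%:R) * ((a%:P + l) ^+ n)`_t|
  <= (E ^+ N)^-1 * ((s.+1%:R * E) ^+ i * expR (j%:R * (s.+1%:R * E)) * 2 ^+ t).
Proof.
(* U = K + T exceeds both the K terms of the partial sum and the T terms of the full one, so both
   become sums over m < U. *)
move=> iN; set K := (N - i)%N; set U := (K + T)%N.
have E0 : 0 < E by apply: lt_le_trans E1.
have -> : \sum_(n < N | (i <= n)%N) (j%:R ^+ (n - i) / (n - i)`!%:R) * ((a%:P + l) ^+
  n)`_t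
   = \sum_(m < U) b m * exp_sum (j%:R * a) (K - m).
  rewrite -partial_b ?leq_addr //.
  rewrite -(big_mkord (fun n => (i <= n)%N) (fun n => (j%:R ^+ (n - i) / (n -
    i)`!%:R) * ((a%:P + l) ^+ n)`_t)).
  rewrite (@big_cat_nat _ _ _ i) //= big_nat_cond big_pred0 ?add0r => [|n]; last by lia.
  rewrite -{1}[i]add0n big_addn big_mkord -/K; apply: eq_big => [n|n _];
    first by rewrite leq_addl.
  by rewrite addnK addnC exprD.
have -> : entry T s j i t (ln 2) = \sum_(m < U) b m * expR (j%:R * a).
  rewrite entry_b mulrC mulr_suml (big_ord_widen U (fun m => b m * expR (j%:R * a)))
    ?leq_addl //.
  rewrite big_mkcond; apply: eq_bigr => m _.
  by case: ltnP => // Tm; rewrite b_ge ?mul0r.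
rewrite -sumrB; apply: le_trans (ler_norm_sum _ _ _) _.
have ja : 0 <= j%:R * a by rewrite mulr_ge0.
have bE m : `|b m| <= j%:R ^+ m / m`!%:R * (s.+1%:R ^+ i * 2 ^+ t).
  rewrite normrM ger0_norm ?divr_ge0 ?exprn_ge0 // ler_wpM2l ?divr_ge0 ?exprn_ge0 //.
  exact: norm_coef_shift_log.
apply: (@le_trans _ _ (\sum_(m < U) (j%:R * E) ^+ m / m`!%:R *
    (s.+1%:R ^+ i * 2 ^+ t * (E ^+ K)^-1 * expR (j%:R * a * E)))).
  apply: ler_sum => m _; rewrite -mulrBr normrM.
  apply: le_trans (ler_pM _ _ (bE m) (exp_sum_tail (K - m) ja E1)) _ => //.
  (* True for m > K too, where the truncated difference is 0; the factor E^m is absorbed into the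
     series of exp(jE). *)
  have h : (E ^+ (K - m))^-1 <= E ^+ m * (E ^+ K)^-1.
    rewrite ler_pdivlMr ?exprn_gt0 // mulrC ler_pdivrMr ?exprn_gt0 // -exprD.
    by apply: ler_weXn2l => //; lia.
  rewrite exprMn; set e := expR _; set X := (_ : R)^-1; set Y := _ * 2 ^+ t.
  have -> : j%:R ^+ m / m`!%:R * Y * (X * e) = (j%:R ^+ m / m`!%:R * Y * e) * X by ring.
  have -> : j%:R ^+ m * E ^+ m / m`!%:R * (Y * (E ^+ K)^-1 * e) =
    (j%:R ^+ m / m`!%:R * Y * e) * (E ^+ m * (E ^+ K)^-1) by ring.
  by rewrite ler_wpM2l // !mulr_ge0 ?invr_ge0 ?exprn_ge0 ?expR_ge0.
rewrite -mulr_suml -/(exp_sum (j%:R * E) U).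
have jE : 0 <= j%:R * E by rewrite mulr_ge0 // ltW.
apply: le_trans (ler_wpM2r _ (exp_sum_le U jE)) _.
  by rewrite !mulr_ge0 ?exprn_ge0 ?invr_ge0 ?expR_ge0 // exprn_ge0 // ltW.
have -> : expR (j%:R * E) * (s.+1%:R ^+ i * 2 ^+ t * (E ^+ K)^-1 * expR (j%:R * a *
  E)) =
    (E ^+ N)^-1 * ((s.+1%:R * E) ^+ i * 2 ^+ t * expR (j%:R * E * (a + 1))).
  have -> : j%:R * E * (a + 1) = j%:R * E + j%:R * a * E by ring.
  have -> : E ^+ N = E ^+ K * E ^+ i by rewrite -exprD subnK.
  rewrite expRD exprMn; field.
  by rewrite !expf_neq0 // gt_eqF.
rewrite ler_wpM2l ?invr_ge0 ?exprn_ge0 ?(ltW E0) // mulrAC.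
rewrite ler_wpM2r ?exprn_ge0 // ler_wpM2l ?exprn_ge0 ?mulr_ge0 ?(ltW E0) //.
rewrite ler_expR -mulrA ler_wpM2l // mulrC.
by rewrite ler_wpM2r // ltW.
Qed.

End Approximation.
End Entries.

(** * The interpolation determinant *)

Definition pair_of_ord a b (l : 'I_#|{: 'I_a * 'I_b}|) : 'I_a * 'I_b := enum_val l.

Lemma sum_pair_of_ord (V : nmodType) a b (F : 'I_a -> 'I_b -> V) :
  \sum_l F (pair_of_ord l).1 (pair_of_ord l).2 = \sum_i \sum_j F i j.
Proof. by rewrite pair_bigA (reindex (@pair_of_ord a b)) //;
  apply: onW_bij (enum_val_bij _). Qed.

Section Core.
Variable R : realType.

(** If the matrix with all S T rows had dependent columns, a relation between them would give
    polynomials p_j of degree below L0 whose combination with the e^(jz) vanishes to order T at S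
    points, more than [zero_estimate] allows. So the columns are independent and some N rows form an
    invertible minor. *)
Lemma entry_minor (x : R) S T L0 L1 :
  x != 0 -> (0 < L1 < T)%N -> (L0 * L1 < S * (T - L1).+1)%N ->
  exists f : 'I_#|{: 'I_L0 * 'I_L1}| -> 'I_S * 'I_T,
   \det (\matrix_(m, l) (entry T (f m).1 (pair_of_ord l).2 (pair_of_ord l).1 (f m).2
     x)) != 0.
Proof.
move=> x0 /andP[L10 L1T] hS.
set N := #|_|; set M := #|{: 'I_S * 'I_T}|.
pose A : 'M[R]_(M, N) := \matrix_(m, l)
  entry T (pair_of_ord m).1 (pair_of_ord l).2 (pair_of_ord l).1 (pair_of_ord m).2 x.
suff rA : row_full A.
  pose g := fullrankfun rA; exists (fun m => pair_of_ord (g m)).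
  have := fullrowsub_unit rA; rewrite unitmxE unitfE; congr (\det _ != 0).
  by apply/matrixP => m l; rewrite !mxE.
rewrite /row_full -mxrank_tr -/(row_free A^T); apply: inj_row_free => u uA.
apply/eqP; apply: contraT => u0.
pose p (j : 'I_L1) : {poly R} :=
  \poly_(i < L0) (if insub i is Some i' then u 0 (enum_rank (i' : 'I_L0, j)) else 0).
have pE j : p j = \sum_(i < L0) u 0 (enum_rank (i, j)) *: 'X^i.
  rewrite /p poly_def; apply: eq_bigr => i _.
  by rewrite valK.
have [j0 pj0] : exists j, p j != 0.
  apply/existsP; apply: contraNT u0; rewrite negb_exists => /forallP p0.
  apply/eqP/rowP => l; rewrite mxE -[l]enum_valK; case: (enum_val l) => i j.
  have /eqP/(congr1 (fun q : {poly R} => q`_i)) := negbNE (p0 j).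
  by rewrite coef_poly ltn_ord valK coef0.
(* Only the nonzero p_j enter [zero_estimate]. Their number n is at most L1, and n (L0 - 1) <= L0 L1
   < S (T - n + 1) is the final contradiction. *)
pose J := [set j | p j != 0]; set n := #|J|.
have n0 : (0 < n)%N by apply/card_gt0P; exists j0; rewrite inE.
have nL : (n <= L1)%N by rewrite -[X in (_ <= X)%N](card_ord L1) max_card.
pose e (k : 'I_n) : nat := (enum_val k : 'I_L1).
pose q (k : 'I_n) : {poly R} := p (enum_val k).
have e_inj : injective e by move=> k k' /val_inj /enum_val_inj.
have q0 k : q k != 0 by have := enum_valP k; rewrite inE.
have c0 (s : nat) (k : 'I_n) : (2 : R) ^+ (s * e k) != 0 by rewrite expf_neq0.
suff H s : (s < S)%N -> 'X^T %|
     \sum_k (2 ^+ (s * e k)) *: ((q k \Po ((s%:R * x)%:P + log1p_poly R T)) * (1 +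
       'X) ^+ e k).
  have := zero_estimate x0 _ e_inj q0 c0 H;
    rewrite n0 (leq_ltn_trans nL) // => /(_ isT).
  have : (\sum_i (size (q i)).-1 <= n * L0.-1)%N.
    rewrite -[n in (n * _)%N]card_ord -sum_nat_const; apply: leq_sum => k _.
    by rewrite -!subn1 leq_sub2r // size_poly.
  nia.
move=> sS; apply/dvdXnP => t tT.
pose m := enum_rank (Ordinal sS, Ordinal tT).
have /matrixP/(_ 0 m) := uA; rewrite !mxE => uAm.
rewrite -[RHS]uAm.
under [RHS]eq_bigr do rewrite 2!mxE /pair_of_ord enum_rankK /=.
pose G (i : 'I_L0) (j : 'I_L1) := u 0 (enum_rank (i, j)) * entry T s j i t x.
rewrite [RHS](eq_bigr (fun l => G (pair_of_ord l).1 (pair_of_ord l).2)) => [|l _];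
  last first.
  by rewrite /G -surjective_pairing enum_valK.
rewrite sum_pair_of_ord exchange_big /= coef_sum.
pose H (j : 'I_L1) := (2 ^+ (s * j) *: ((p j \Po ((s%:R * x)%:P + log1p_poly R T)) *
  (1 + 'X) ^+ j))`_t.
transitivity (\sum_(k < n) H (enum_val k)); first by apply: eq_bigr.
rewrite -(big_enum_val H) /= big_mkcond; apply: eq_bigr => j _.
have -> : (if j \in J then H j else 0) = H j.
  rewrite inE; case: eqP => // pj; rewrite /H pj.
  by rewrite comp_poly0 mul0r scaler0 coef0.
rewrite /H coefZ pE raddf_sum /= mulr_suml coef_sum mulr_sumr; apply: eq_bigr => i _.
rewrite comp_polyZ comp_Xn_poly -scalerAl coefZ /G /entry.
by rewrite mulrCA.
Qed.


Lemma sum_ord_shift (V : nmodType) i N (F : nat -> V) : (i <= N)%N ->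
  \sum_(n < N | (i <= n)%N) F (n - i)%N = \sum_(k < N - i) F k.
Proof.
move=> iN; rewrite -(big_mkord (fun n => (i <= n)%N) (fun n => F (n - i)%N)).
rewrite (@big_cat_nat _ _ _ i) //= big_nat_cond big_pred0 ?add0r => [|n]; last by lia.
rewrite -{1}[i]add0n big_addn big_mkord; apply: eq_big => [n|n _].
  by rewrite leq_addl.
by rewrite addnK.
Qed.

(** Applies [interpolation_det_le] with ratio 1/E to the transposed matrix, whose rows belong to the
    functions z^i e^(jz): their Taylor coefficients depend on the function only, the powers of z on
    the point only. *)
Lemma minor_det_le (xi E : R) S T L0 L1
    (f : 'I_#|{: 'I_L0 * 'I_L1}| -> 'I_S * 'I_T) :
  1 <= E -> `|xi| <= 1 -> (0 < L1)%N -> L0%:R * `|ln 2 - xi| <= (E ^+ (L0 * L1))^-1 ->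
  `|\det (\matrix_(m, l) (entry T (f m).1 (pair_of_ord l).2 (pair_of_ord l).1 (f m).2
    xi))|
  <= (L0 * L1)`!%:R * (E^-1) ^+ 'C(L0 * L1, 2) *
     \prod_(i < L0) \prod_(j < L1)
       (3 * ((S%:R * E) ^+ i * expR (j%:R * (S%:R * E)) * 2 ^+ T)).
Proof.
move=> E1 xi1 L10.
have NE : #|{: 'I_L0 * 'I_L1}| = (L0 * L1)%N by rewrite card_prod !card_ord.
rewrite -NE; set N := #|_| => xi_near; set M := (X in \det X).
have E0 : 0 < E by apply: lt_le_trans E1.
pose BL (i j : nat) : R := (S%:R * E) ^+ i * expR (j%:R * (S%:R * E)) * 2 ^+ T.
have SE0 : 0 <= S%:R * E by rewrite mulr_ge0 // ltW.
have BL0 i j : 0 <= BL i j by rewrite !mulr_ge0 ?exprn_ge0 ?expR_ge0.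
have two_le_e : (2 : R) <= expR 1 by have := @expR_ge1Dx R 1; apply: le_trans; lra.
have ln20 : 0 <= ln (2 : R) by apply: ln_ge0; lra.
have ln21 : ln (2 : R) <= 1.
  by have := @le_ln1Dx R 1; rewrite -[1 + 1]/(2%:R); apply; lra.
pose w (m : 'I_N) (n : nat) : R := ((((f m).1%:R * ln 2)%:P + log1p_poly R T) ^+
  n)`_(f m).2.
pose cf (i j n : nat) : R := if (i <= n)%N then j%:R ^+ (n - i) / (n - i)`!%:R else 0.
pose il (l : 'I_N) : 'I_L0 := (pair_of_ord l).1;
  pose jl (l : 'I_N) : 'I_L1 := (pair_of_ord l).2.
pose err (l m : 'I_N) := M m l - \sum_(n < N) cf (il l) (jl l) n * w m n.
pose c (l : 'I_N) (n : 'I_N.+1) : R := if (n < N)%N then cf (il l) (jl l) n else 1.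
pose v (l : 'I_N) (n : 'I_N.+1) (m : 'I_N) : R := if (n < N)%N then w m n else err l m.
(* The bounds for the powers add up to at most [BL], by the exponential series, and the remainder
   adds 2 [BL]; hence the factor 3 in the statement. *)
pose B (l : 'I_N) (n : 'I_N.+1) : R :=
  if (n < N)%N then
    (if (il l <= n)%N then (((jl l)%:R * (S%:R * E)) ^+ (n - il l) / (n - il l)`!%:R) *
      ((S%:R * E) ^+ il l * 2 ^+ T) else 0)
  else 2 * BL (il l) (jl l).
have iN (l : 'I_N) : (il l <= N)%N.
  by rewrite /N NE (leq_trans (ltnW (ltn_ord (il l)))) // leq_pmulr.
have sS (m : 'I_N) : ((f m).1.+1%:R : R) <= S%:R by rewrite ler_nat.
have tT (m : 'I_N) : (2 : R) ^+ (f m).2 <= 2 ^+ T.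
  by apply: ler_weXn2l; [lra|rewrite ltnW].
(* One [BL] pays for replacing [xi] by log 2, by [entry_lip] and the closeness of [xi]; the other
   pays for cutting the series, by [entry_approx]. *)
have errE l m : `|err l m| <= (E ^+ N)^-1 * (2 * BL (il l) (jl l)).
  set a := \sum_(n < N) cf (il l) (jl l) n * w m n.
  have -> : err l m = (entry T (f m).1 (jl l) (il l) (f m).2 xi -
      entry T (f m).1 (jl l) (il l) (f m).2 (ln 2)) +
      (entry T (f m).1 (jl l) (il l) (f m).2 (ln 2) - a).
    by rewrite /err /M mxE subrKA.
  apply: le_trans (ler_normD _ _) _.
  have -> : (E ^+ N)^-1 * (2 * BL (il l) (jl l)) =
    (E ^+ N)^-1 * BL (il l) (jl l) + (E ^+ N)^-1 * BL (il l) (jl l) by ring.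
  have E2 : 0 <= (E ^+ N)^-1 by rewrite invr_ge0 exprn_ge0 // ltW.
  have sSE : (f m).1.+1%:R * E <= S%:R * E by rewrite ler_wpM2r ?(ltW E0).
  apply: lerD.
    apply: le_trans (entry_lip _ _ _ _ _ xi1 _) _; first by rewrite ger0_norm.
    apply: ler_pM; rewrite ?mulr_ge0 ?exprn_ge0 //.
      apply: le_trans xi_near; rewrite distrC ler_wpM2r // ler_nat.
      by rewrite ltnW.
    rewrite ler_pM ?mulr_ge0 ?exprn_ge0 //.
    rewrite ler_pM ?exprn_ge0 //.
      apply: lerXn2r; rewrite ?nnegrE ?mulr_ge0 ?(ltW E0) //.
      by apply: le_trans (sS m) _; rewrite ler_peMr.
    apply: le_trans (_ : expR 1 ^+ ((f m).1.+1 * jl l) <= _).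
      by apply: lerXn2r; rewrite ?nnegrE ?expR_ge0.
    rewrite -expRM_natl mulr1 ler_expR natrM mulrC ler_wpM2l //.
    by apply: le_trans (sS m) _; rewrite ler_peMr.
  apply: le_trans (_ : (E ^+ N)^-1 * (((f m).1.+1%:R * E) ^+ (il l) * expR ((jl l)%:R
    * ((f m).1.+1%:R * E)) * 2 ^+ (f m).2) <= _).
    have -> : a = \sum_(n < N | (il l <= n)%N) ((jl l)%:R ^+ (n - il l) / (n - il
      l)`!%:R) * w m n.
      rewrite /a [RHS]big_mkcond; apply: eq_bigr => n _.
      by rewrite /cf; case: ifP; rewrite ?mul0r.
    exact: entry_approx.
  have sE0 : 0 <= (f m).1.+1%:R * E by rewrite mulr_ge0 // ltW.
  rewrite ler_wpM2l //; apply: ler_pM => //;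
    first by rewrite mulr_ge0 ?exprn_ge0 ?expR_ge0.
  apply: ler_pM; rewrite ?exprn_ge0 ?expR_ge0 //.
    by apply: lerXn2r; rewrite ?nnegrE ?mulr_ge0 ?(ltW E0).
  by rewrite ler_expR ler_wpM2l.
have rho01 : 0 < E^-1 <= 1 by rewrite invr_gt0 E0 invf_le1.
rewrite -det_tr.
apply: le_trans (@interpolation_det_le R N _ (E^-1) c v B rho01 _ _ _) _.
- move=> l m; rewrite mxE big_ord_recr /= /c /v ltnn mul1r.
  rewrite (eq_bigr (fun n : 'I_N => cf (il l) (jl l) n * w m n)) => [|n _];
    last by rewrite /= ltn_ord.
  by rewrite /err addrC subrK.
- by move=> l l' n m nN; rewrite /v nN.
- move=> l n m; rewrite /c /v /B; case: ltnP => nN; last first.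
    have -> : (n : nat) = N by apply/eqP; rewrite eqn_leq nN -ltnS ltn_ord.
    by rewrite mul1r exprVn errE.
  rewrite /cf; case: ifP => il_n; last by rewrite mul0r normr0 mulr0.
  have wE : `|w m n| <= S%:R ^+ n * 2 ^+ T.
    have := @norm_coef_shift_log R T (f m).1 (f m).2 n 0;
      rewrite expr0 mulr1 => /le_trans; apply.
    rewrite ler_pM ?exprn_ge0 //.
    by apply: lerXn2r; rewrite ?nnegrE.
  have j0 : 0 <= (jl l)%:R ^+ (n - il l) / (n - il l)`!%:R :> R by rewrite divr_ge0
    ?exprn_ge0.
  rewrite normrM (ger0_norm j0); apply: le_trans (ler_wpM2l j0 wE) _.
  have En : E ^+ n = E ^+ (n - il l) * E ^+ il l by rewrite -exprD subnK.
  have Sn : S%:R ^+ n = S%:R ^+ (n - il l) * S%:R ^+ il l :> R by rewrite -exprD subnK.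
  rewrite exprVn En Sn !exprMn le_eqVlt; apply/orP; left; apply/eqP; field.
  by rewrite !expf_neq0 ?gt_eqF ?ltr0n ?fact_gt0.
rewrite ler_wpM2l ?mulr_ge0 ?exprn_ge0 ?invr_ge0 ?(ltW E0) //.
have -> : \prod_(i < L0) \prod_(j < L1)
       (3 * ((S%:R * E) ^+ i * expR (j%:R * (S%:R * E)) * 2 ^+ T)) = \prod_(l < N) (3
         * BL (il l) (jl l)).
  by rewrite pair_bigA (reindex (@pair_of_ord L0 L1)) //;
    apply: onW_bij (enum_val_bij _).
apply: ler_prod => l _; apply/andP; split.
  apply: sumr_ge0 => n _; rewrite /B; case: ifP => _; last by rewrite mulr_ge0.
  by case: ifP => // _; rewrite !mulr_ge0 ?invr_ge0 ?exprn_ge0 // mulr_ge0.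
rewrite big_ord_recr /= {2}/B ltnn.
have -> : 3 * BL (il l) (jl l) = BL (il l) (jl l) + 2 * BL (il l) (jl l) by ring.
rewrite lerD2r (eq_bigr (fun n : 'I_N => if (il l <= n)%N then
    ((jl l)%:R * (S%:R * E)) ^+ (n - il l) / (n - il l)`!%:R *
      ((S%:R * E) ^+ il l * 2 ^+ T) else 0)) => [|n _]; last by rewrite /B /= ltn_ord.
rewrite -big_mkcond /= -mulr_suml.
rewrite (sum_ord_shift (fun k => ((jl l)%:R * (S%:R * E)) ^+ k / k`!%:R)) //.
have jSE : 0 <= (jl l)%:R * (S%:R * E) by rewrite mulr_ge0.
rewrite -/(exp_sum _ _); apply: le_trans (ler_wpM2r _ (exp_sum_le _ jSE)) _.
  by rewrite mulr_ge0 ?exprn_ge0.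
by rewrite /BL mulrCA mulrA.
Qed.

End Core.

Lemma prod_grid (R : comNzRingType) a b (c x y : R) :
  \prod_(i < a) \prod_(j < b) (c * x ^+ i * y ^+ j) =
  c ^+ (a * b) * x ^+ (b * 'C(a, 2)) * y ^+ (a * 'C(b, 2)).
Proof.
have sumE n : (\sum_(i < n) i = 'C(n, 2))%N by rewrite -triangular_sum big_mkord.
under eq_bigr => i _.
  rewrite big_split /= prodr_const card_ord -expr_sum sumE.
  over.
rewrite big_split /= prodr_const card_ord -exprM [(_ * a)%N]mulnC.
congr (_ * _); under eq_bigr do rewrite exprMn -exprM.
by rewrite big_split /= prodr_const card_ord -exprM mulnC -expr_sum -big_distrl /=
  sumE [('C(_, _) * _)%N]mulnC.
Qed.

Lemma irreducible_coprimep (R : realType) (P Q : {poly int}) (x : R) :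
  irreducible_poly P -> zpoly_eval P x = 0 -> zpoly_eval Q x != 0 -> coprimep P Q.
Proof.
move=> [_ irrP] Px Qx; rewrite coprimep_def; apply: contraNT Qx => g1.
have PQ : P %| Q.
  rewrite -(eqp_dvdl _ (irrP _ g1 (dvdp_gcdl _ _))); exact: dvdp_gcdr.
have /Pdiv.Idomain.dvdpP [[c r] /= c0 cE] := PQ.
have : c%:~R * zpoly_eval Q x = 0 by rewrite -zpoly_evalZ cE zpoly_evalM Px mulr0.
by move/eqP; rewrite mulf_eq0 intr_eq0 (negPf c0).
Qed.

Section Core.
Variable R : realType.

Lemma minor_zpoly (xi : R) S T L0 L1 (f : 'I_#|{: 'I_L0 * 'I_L1}| -> 'I_S * 'I_T) :
  exists Q : {poly int}, [/\ (size Q <= (L1 * 'C(L0, 2)).+1)%N,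
    zpoly_eval Q xi = (prod_lcm L0 T)%:R ^+ (L0 * L1) *
      \det (\matrix_(m, l) (entry T (f m).1 (pair_of_ord l).2 (pair_of_ord l).1 (f
        m).2 xi)) &
    (zpoly_length Q)%:~R <= (L0 * L1)`!%:R * ((prod_lcm L0 T)%:R * 2 ^+ T) ^+ (L0 *
      L1) *
       S%:R ^+ (L1 * 'C(L0, 2)) * (2 ^+ S) ^+ (L0 * 'C(L1, 2)) :> R].
Proof.
set La := prod_lcm L0 T.
have NE : #|{: 'I_L0 * 'I_L1}| = (L0 * L1)%N by rewrite card_prod !card_ord.
have /choice [F HF] (lm : 'I_#|{: 'I_L0 * 'I_L1}| * 'I_#|{: 'I_L0 * 'I_L1}|) :=
  entry_zpoly R (f lm.2).1 (pair_of_ord lm.1).2 (ltn_ord (f lm.2).2) (ltn_ord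
    (pair_of_ord lm.1).1).
pose A : 'M[{poly int}]_#|{: 'I_L0 * 'I_L1}| := \matrix_(l, m) F (l, m).
exists (\det A); split.
- apply: leq_trans (size_sum _ _ _) _; apply/bigmax_leqP => s _.
  have -> : size ((-1) ^+ s * \prod_i A i (s i))%R = size (\prod_i A i (s i))%R.
    by case: (odd_perm s); rewrite ?expr0 ?mul1r // expr1 mulN1r size_polyN.
  have sA l : (size (A l (s l)) <= ((pair_of_ord l).1 : nat).+1)%N.
    by rewrite mxE; have [] := HF (l, s l).
  have [+ _] := coef_prod_top sA; congr (_ <= _.+1)%N.
  rewrite (sum_pair_of_ord (fun i j => i : nat)).
  under eq_bigr do rewrite sum_nat_const card_ord.
  by rewrite -big_distrr /= -(big_mkord xpredT id) triangular_sum.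
- rewrite /zpoly_eval -det_map_mx -[_.[xi]]/(horner_eval xi _) -det_map_mx -NE.
  rewrite -detZ -[RHS]det_tr; congr (\det _); apply/matrixP => l m; rewrite !mxE.
  by have [_ + _] := HF (l, m); rewrite /zpoly_eval => <-.
have fS (m : 'I_#|{: 'I_L0 * 'I_L1}|) : ((f m).1.+1%:R : R) <= S%:R by rewrite ler_nat.
apply: le_trans (@zpoly_length_det _ A R (fun l => La%:R * 2 ^+ T * S%:R ^+
  (pair_of_ord l).1 * (2 ^+ S) ^+ (pair_of_ord l).2) _) _.
  move=> l m; rewrite mxE; have [_ _ +] := HF (l, m) => /le_trans; apply => /=.
  rewrite -!mulrA ler_wpM2l // [leRHS]mulrCA ler_pM ?exprn_ge0 ?mulr_ge0 ?exprn_ge0 //.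
    by apply: lerXn2r; rewrite ?nnegrE.
  rewrite mulrC ler_pM ?exprn_ge0 //.
    by apply: ler_weXn2l; [lra|rewrite ltnW].
  by rewrite -exprM; apply: ler_weXn2l; [lra|rewrite leq_mul2r ltn_ord orbT].
have -> : \prod_(l : 'I_#|{: 'I_L0 * 'I_L1}|) (La%:R * 2 ^+ T * S%:R ^+ (pair_of_ord
  l).1 * (2 ^+ S) ^+ (pair_of_ord l).2) =
    (La%:R * 2 ^+ T) ^+ (L0 * L1) * S%:R ^+ (L1 * 'C(L0, 2)) * (2 ^+ S) ^+ (L0 *
      'C(L1, 2)) :> R.
  rewrite -prod_grid pair_bigA; symmetry.
  by rewrite (reindex (@pair_of_ord L0 L1)) //; apply: onW_bij (enum_val_bij _).
by rewrite NE !mulrA.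
Qed.

(** Q takes at [xi] a value bounded above by [minor_det_le] and below by the resultant with P, in
    which only the term with Q([xi]) survives as P([xi]) = 0. The statement is the logarithm of the
    comparison. *)
Lemma core_inequality (P : {poly int}) (xi L E : R) d S T L0 L1 N D G :
  irreducible_poly P -> size P = d.+1 -> (zpoly_length P)%:~R <= L ->
  zpoly_eval P xi = 0 -> xi != 0 -> `|xi| <= 1 -> 1 <= E -> (0 < L0)%N ->
  (0 < L1 < T)%N -> (L0 * L1 < S * (T - L1).+1)%N ->
  L0%:R * `|ln 2 - xi| <= (E ^+ (L0 * L1))^-1 ->
  N = (L0 * L1)%N -> D = (L1 * 'C(L0, 2))%N -> G = (L0 * 'C(L1, 2))%N ->
  'C(N, 2)%:R * ln E <= ln d%:R +
    d%:R * (N%:R * ln (prod_lcm L0 T)%:R + N%:R * ln N%:R + (N * T)%:R * ln 2 + D%:R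
      * ln S%:R) +
    (G * S)%:R * (d%:R * ln 2 + E) + N%:R * ln 3 + D%:R * (ln E + ln L).
Proof.
move=> irrP sP PL Pxi xi0 xi1 E1 L00 L1T hS near NE DE GE.
have /andP[L10 _] := L1T.
have [f detf] := entry_minor xi0 L1T hS.
have [Q [sQ Qxi lenQ]] := minor_zpoly xi f.
have up := minor_det_le f E1 xi1 L10 near.
rewrite -NE -DE -GE in lenQ; rewrite -NE in Qxi up; rewrite -DE in sQ.
set La := prod_lcm L0 T in Qxi lenQ *; set De := \det _ in detf Qxi up.
have La0 : (0 : R) < La%:R by rewrite ltr0n prod_lcm_gt0.
have E0 : 0 < E by apply: lt_le_trans E1.
have S0 : (0 : R) < S%:R by rewrite ltr0n; move: hS; case: (S).
have Qx0 : zpoly_eval Q xi != 0 by rewrite Qxi mulf_neq0 // expf_neq0 // gt_eqF.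
have cPQ := irreducible_coprimep irrP Pxi Qx0.
have d0 : (0 < d)%N by case: irrP; rewrite sP.
have Q0 : Q != 0 by apply: contraNneq Qx0 => ->; rewrite /zpoly_eval rmorph0 horner0.
have sQ1 : size Q = (size Q).-1.+1 by rewrite prednK // size_poly_gt0.
have := coprimep_eval_ge cPQ sP sQ1 d0 xi1.
rewrite Pxi normr0 mulr0 !mul0r add0r Qxi normrM ger0_norm ?exprn_ge0 ?(ltW La0) //.
set n := (size Q).-1; have nD : (n <= D)%N by rewrite -ltnS -sQ1.
have P0 : P != 0 by rewrite -size_poly_eq0 sP.
have lP1 : (1 : R) <= (zpoly_length P)%:~R by rewrite -[1]/(1%:~R) ler_int
  zpoly_length_ge1.
have L1' : 1 <= L := le_trans lP1 PL.
have L0' : 0 < L by apply: lt_le_trans L1'.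
pose BQ : R := N`!%:R * (La%:R * 2 ^+ T) ^+ N * S%:R ^+ D * (2 ^+ S) ^+ G.
pose BD : R := N`!%:R * (E^-1) ^+ 'C(N, 2) * ((3 * 2 ^+ T) ^+ N * (S%:R * E) ^+ D *
  expR (S%:R * E) ^+ G).
have upD : `|De| <= BD.
  apply: le_trans up _; rewrite /BD NE DE GE -prod_grid -NE.
  rewrite ler_wpM2l ?mulr_ge0 ?exprn_ge0 ?invr_ge0 ?(ltW E0) //.
  apply: ler_prod => i _; rewrite prodr_ge0 /= => [|j _].
    by rewrite le_eqVlt; apply/orP; left; apply/eqP; apply: eq_bigr => j _;
      rewrite expRM_natl; ring.
  by rewrite !mulr_ge0 ?exprn_ge0 ?expR_ge0 // mulr_ge0 // ltW.
have lQ0 : (0 : R) <= (zpoly_length Q)%:~R by rewrite ler0z zpoly_length_ge0.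
have BQ0 : 0 < BQ.
  by rewrite /BQ; repeat first [apply: mulr_gt0 | apply: exprn_gt0] => //;
    rewrite ltr0n fact_gt0.
move=> low.
have {low} : 1 <= d%:R * (La%:R ^+ N * BD) * L ^+ D * BQ ^+ d.-1.
  apply: le_trans low _; apply: ler_pM; rewrite ?mulr_ge0 ?exprn_ge0 ?(ltW La0) //.
  - by rewrite (le_trans ler01).
  - apply: ler_pM; rewrite ?mulr_ge0 ?exprn_ge0 ?(ltW La0) //.
    + by rewrite (le_trans ler01).
    + by rewrite ler_wpM2l // ler_wpM2l ?exprn_ge0 ?(ltW La0).
    apply: le_trans (_ : L ^+ n <= _); last exact: ler_weXn2l.
    by apply: lerXn2r; rewrite ?nnegrE ?(ltW L0') // (le_trans ler01).
  by apply: lerXn2r; rewrite ?nnegrE ?(ltW BQ0).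
(* The factors N!, [La]^N, 2^(TN) and S^D make up another [BQ] except for its factor (2^S)^G, which
   is divided out; so [BQ] occurs to the power d. *)
have -> : d%:R * (La%:R ^+ N * BD) * L ^+ D * BQ ^+ d.-1 =
   (E ^+ 'C(N, 2))^-1 * (d%:R * (3 ^+ N * expR (S%:R * E) ^+ G * E ^+ D * L ^+ D) *
     ((2 ^+ S) ^+ G)^-1 * BQ ^+ d).
  have -> : BQ ^+ d = BQ * BQ ^+ d.-1 by rewrite -exprS prednK.
  set Z := BQ ^+ d.-1; rewrite /BD exprVn /BQ; set u := (2 ^+ S) ^+ G; set w := 2 ^+ T.
  have u0 : u != 0 by rewrite !expf_neq0.
  rewrite !exprMn; field.
  by rewrite u0 !expf_neq0 // gt_eqF.
rewrite mulrC ler_pdivlMr ?exprn_gt0 // mul1r.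
set X := (X in _ <= X) => EX.
have X0 : 0 < X.
  by repeat first [apply: mulr_gt0 | apply: exprn_gt0] => //;
    rewrite ?expR_gt0 ?invr_gt0 ?exprn_gt0 ?ltr0n.
have h : ln (E ^+ 'C(N, 2)) <= ln X by rewrite ler_ln ?posrE ?exprn_gt0.
have N0 : (0 < N)%N by rewrite NE muln_gt0 L00.
have lnfact : ln (N`!%:R : R) <= N%:R * ln N%:R.
  rewrite mulr_natl -lnXn ?ltr0n // ler_ln ?posrE ?exprn_gt0 ?ltr0n ?fact_gt0 //.
  rewrite -natrX ler_nat fact_prod big_add1 big_mkord.
  by rewrite -[X in (_ <= N ^ X)%N]card_ord -prod_nat_const leq_prod.
have dR0 : (0 : R) < d%:R by rewrite ltr0n.
have NR0 : (0 : R) < N`!%:R by rewrite ltr0n fact_gt0.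
have lnX (x : R) n' : 0 < x -> ln (x ^+ n') = n'%:R * ln x by move=> x0;
  rewrite lnXn // mulr_natl.
have La2 : 0 < La%:R * 2 ^+ T :> R by rewrite mulr_gt0 ?exprn_gt0.
move: h; rewrite lnX // /X !lnM ?posrE ?mulr_gt0 ?exprn_gt0 ?mulr_gt0 ?exprn_gt0
  ?expR_gt0 ?invr_gt0 ?exprn_gt0 //.
rewrite !lnX ?mulr_gt0 ?exprn_gt0 ?mulr_gt0 ?exprn_gt0 ?expR_gt0 ?invr_gt0 ?exprn_gt0
  //.
rewrite expRK lnV ?posrE ?exprn_gt0 // /BQ !lnM ?posrE ?exprn_gt0 ?mulr_gt0
  ?exprn_gt0 //.
rewrite !lnX ?exprn_gt0 //.
rewrite !lnM ?posrE ?exprn_gt0 // !lnX //.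
have := ler_wpM2l (ltW dR0) lnfact.
rewrite !natrM; set a := ln N`!%:R; set b := ln N%:R; move=> h1 h2.
apply: le_trans h2 _.
(* The slack consists of log N! <= N log N and of the logarithm of the divided factor (2^S)^G. *)
rewrite -subr_ge0; set lhs := (X in 0 <= X).
have -> : lhs = d%:R * (N%:R * b) - d%:R * a + G%:R * (S%:R * ln 2).
  by rewrite /lhs; ring.
by rewrite addr_ge0 ?subr_ge0 // !mulr_ge0 // ln_ge0 // ler1n.
Qed.

End Core.

(** * The choice of parameters *)

Section Numeric.
Variable R : realType.

Lemma expR_ge_pow (x : R) n : 0 <= 1 + x -> (1 + x) ^+ n <= expR (n%:R * x).
Proof.
move=> x0; rewrite expRM_natl; apply: lerXn2r; rewrite ?nnegrE ?expR_ge0 //.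
exact: expR_ge1Dx.
Qed.

Lemma ln_le_of_le_expR (x y : R) : 0 < x -> x <= expR y -> ln x <= y.
Proof. by move=> x0 xy; rewrite -[y]expRK ler_ln ?posrE ?expR_gt0. Qed.

Lemma ln2_ge0 : 0 <= ln (2 : R). Proof. by apply: ln_ge0; lra. Qed.

Lemma ln2_le : ln (2 : R) <= 3 / 4.
Proof.
apply: ln_le_of_le_expR => //.
have := @expR_ge_pow (3 / 40) 10; have -> : 10%:R * (3 / 40) = 3 / 4 :> R by lra.
move=> h; apply: le_trans (h _); last by lra.
rewrite !exprS expr0; lra.
Qed.

Lemma expR1_le : expR 1 <= 29 / 10 :> R.
Proof.
have := @expR_ge_pow (- (1 / 10)) 10; have -> : 10%:R * (- (1 / 10)) = - 1 :> R by lra.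
rewrite expRN => h.
have {}h : 10 / 29 <= (expR 1 : R)^-1.
  by apply: le_trans (h _); [rewrite !exprS expr0; lra|lra].
rewrite -[leLHS]invrK -[leRHS]invrK lef_pV2 ?posrE ?invr_gt0 ?expR_gt0 //.
by apply: le_trans h; lra.
Qed.

Lemma expR1_ge : 5 / 2 <= expR 1 :> R.
Proof.
have := @expR_ge_pow (1 / 10) 10; have -> : 10%:R * (1 / 10) = 1 :> R by lra.
move=> h; apply: le_trans (h _); last by lra.
rewrite !exprS expr0; lra.
Qed.

Lemma ln_le_nat (x : R) n : 0 < x -> x <= (5 / 2) ^+ n -> ln x <= n%:R.
Proof.
move=> x0 xn; apply: ln_le_of_le_expR => //; apply: le_trans xn _.
rewrite -[n%:R]mulr1 expRM_natl; apply: lerXn2r;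
  rewrite ?nnegrE ?expR_ge0 ?expR1_ge //; lra.
Qed.

Lemma ln12_le : ln (12 : R) <= 3.
Proof. by apply: (@ln_le_nat _ 3); rewrite ?ltr0n // !exprS expr0; lra. Qed.

Lemma ln3_ge1 : 1 <= ln (3 : R).
Proof.
rewrite -[leLHS]expRK ler_ln ?posrE ?expR_gt0 //.
by apply: le_trans expR1_le _; lra.
Qed.

Lemma ln_le_sub1 (x : R) : 0 < x -> ln x <= x - 1.
Proof.
move=> x0; have -> : x = 1 + (x - 1) by ring.
by rewrite [1 + _ - 1]addrAC subrr add0r; apply: le_ln1Dx; lra.
Qed.

Lemma ln_ge_1Bv (x : R) : 0 < x -> 1 - x^-1 <= ln x.
Proof.
move=> x0; have := @ln_le_sub1 x^-1; rewrite invr_gt0 x0 lnV ?posrE // => /(_ isT).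
by lra.
Qed.

(** By [lcm_upto_le] the logarithm is at most 3 log 2 times the sum of T / l for l <= K, a harmonic
    sum. *)
Lemma ln_prod_lcm_le K T : (0 < K)%N ->
  ln ((prod_lcm K T)%:R : R) <= (3 * ln 2) * T%:R * (1 + ln K%:R).
Proof.
have lnlcm n : ln ((lcm_upto n)%:R : R) <= 3 * ln 2 * n%:R.
  have -> : 3 * ln 2 * n%:R = ln (8%:R ^+ n : R).
    have -> : 8%:R = 2 ^+ 3 :> R by rewrite -natrX.
    by rewrite !lnXn ?exprn_gt0 // -[ln 2 *+ 3]mulr_natl -[RHS]mulr_natr.
  rewrite ler_ln ?posrE ?exprn_gt0 ?ltr0n ?lcm_upto_gt0 //.
  by rewrite -natrX ler_nat lcm_upto_le.
have l2 := ln2_ge0.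
elim: K => [//|[|K] IH] _.
  by rewrite /prod_lcm big_nat1 divn1 ln1 addr0 mulr1.
have K0 : (0 : R) < K.+2%:R by rewrite ltr0n.
have K1 : (0 : R) < K.+1%:R by rewrite ltr0n.
rewrite /prod_lcm big_nat_recr //= -/(prod_lcm K.+1 T) natrM lnM ?posrE ?ltr0n
  ?prod_lcm_gt0 ?lcm_upto_gt0 //.
apply: le_trans (lerD (IH isT) (lnlcm _)) _.
have divE : (T %/ K.+2)%:R <= T%:R * (K.+2%:R)^-1 :> R.
  by rewrite ler_pdivlMr // -natrM ler_nat leq_divM.
have lnE : (K.+2%:R)^-1 <= ln K.+2%:R - ln K.+1%:R :> R.
  rewrite -ln_div ?posrE //; apply: le_trans (ln_ge_1Bv _); last by rewrite divr_gt0.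
  have KE : K.+2%:R = K.+1%:R + 1 :> R by rewrite natr1.
  rewrite invf_div; have -> : 1 - K.+1%:R / K.+2%:R = (K.+2%:R)^-1 :> R; last by [].
  have nz := lt0r_neq0 K0.
  by apply: (mulfI nz);
    rewrite mulrBr mulr1 mulrCA mulfV // mulr1 KE addrAC subrr add0r.
apply: le_trans (_ : 3 * ln 2 * T%:R * (1 + ln K.+1%:R) + 3 * ln 2 * T%:R * (ln
  K.+2%:R - ln K.+1%:R) <= _); last first.
  by rewrite -mulrDr; rewrite le_eqVlt; apply/orP; left; apply/eqP; ring.
rewrite lerD2l -[leRHS]mulrA ler_wpM2l ?mulr_ge0 //.
by apply: le_trans divE _; rewrite ler_wpM2l.
Qed.


(* y is the common unit of all terms: the main term is 72 y, the other ones   *)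
(* add up to less than 67 y.                                                  *)
Lemma parameter_inequality (d tau L1 l W lam lS lLa lL0 lN l2 E l3 N L0 T S D G : R) :
  1 <= d -> 1 <= l <= d -> d <= W -> l <= W -> W = lam + d * (l - 1) ->
  1 <= lam -> 15 * d <= tau * l -> 24 * W <= L1 * l ->
  S = 12 * 12 * d -> L0 = S * tau -> T = (tau + 1) * L1 -> N = L0 * L1 ->
  2 * D = N * (L0 - 1) -> 2 * G = N * (L1 - 1) ->
  0 <= lS <= 6 + (l - 1) -> lL0 <= 9 + 2 * (l - 1) ->
  lLa <= 9 / 4 * T * (1 + lL0) ->
  lN <= 6 + d + tau + L1 -> 0 <= l2 <= 3 / 4 -> 0 <= E <= 29 / 10 * d -> l3 <= 2 ->
  N * (N - 1) / 2 * l <= l - 1 + d * (N * lLa + N * lN + N * T * l2 + D * lS)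
     + G * S * (d * l2 + E) + N * l3 + D * (l + lam) -> False.
Proof.
move=> d1 /andP[l1 ld] dW lW WE lam1 taul L1l SE L0E TE NE DE GE /andP[lS0 lSle]
  lL0le lLale lNle
  /andP[l20 l2le] /andP[E0 Ele] l3le h.
have d0 : 0 <= d by clear - d1; lra.
have l0 : 0 < l by clear - l1; lra.
have W1 : 1 <= W by clear - d1 dW; lra.
have tau0 : 15 <= tau.
  have : 15 * l <= tau * l by apply: le_trans taul; clear - ld; lra.
  by rewrite ler_pM2r.
have L10 : 24 <= L1.
  have : 24 * l <= L1 * l by apply: le_trans L1l; clear - lW; lra.
  by rewrite ler_pM2r.
have tau_ge0 : 0 <= tau by clear - tau0; lra.
have L1_ge0 : 0 <= L1 by clear - L10; lra.
set y := d * tau * L1 * l.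
have y0 : 0 < y.
  rewrite /y mulr_gt0 // !mulr_gt0 //; [clear - d1|clear - tau0|clear - L10]; lra.
have S0 : 0 <= S by rewrite SE !mulr_ge0.
have L00 : 0 <= L0 by rewrite L0E mulr_ge0.
(* Hence the left side, divided by N, is 72 y - l / 2. *)
have yN : N * l = 144 * y by rewrite NE L0E SE /y -[144%:R]/((12 * 12)%:R) natrM; ring.
have N1 : 1 <= N.
  rewrite NE L0E SE -[leLHS]mulr1 ler_pM //; last by clear - L10; lra.
  rewrite -[leLHS]mulr1 ler_pM //; last by clear - tau0; lra.
  by rewrite -[leLHS]mulr1 ler_pM //; lra.
have N0 : 0 < N by apply: lt_le_trans N1.
have dtW : d * tau * (24 * W) <= y by rewrite /y -[leRHS]mulrA ler_wpM2l ?mulr_ge0.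
have ddL : d * L1 * (15 * d) <= y.
  have -> : y = d * L1 * (tau * l) by rewrite /y; ring.
  by rewrite ler_wpM2l ?mulr_ge0.
(* The growth of the exponentials and the powers 2^(sj); small because tau l >= 15 d. *)
have c1 : L1 / 2 * S * (d * l2 + E) <= 18 * y.
  have a1 : d * l2 + E <= 73 / 20 * d.
    have : d * l2 <= d * (3 / 4) by rewrite ler_wpM2l.
    by clear - Ele; lra.
  apply: le_trans (ler_wpM2l _ a1) _; first by rewrite !mulr_ge0.
  have -> : L1 / 2 * S * (73 / 20 * d) = 73 / 20 * (24 / 5) * (d * L1 * (15 * d)) by
    rewrite SE; field.
  apply: le_trans (ler_wpM2l _ ddL) _; first by rewrite !mulr_ge0.
  by clear - y0; lra.
(* The common denominator and the powers 2^T; T exceeds tau L1 by at most a factor 16/15, as tau >=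
   15. *)
have c2 : d * lLa + d * T * l2 <= 25 * y.
  have TE' : T <= 16 / 15 * (tau * L1).
    have : 15 * L1 <= tau * L1 by rewrite ler_wpM2r.
    by rewrite TE mulrDl; clear; lra.
  have T0 : 0 <= T by rewrite TE mulr_ge0 // addr_ge0.
  have a1 : lLa + T * l2 <= T * (93 / 4 * l).
    apply: le_trans (_ : 9 / 4 * T * (10 * l) + T * (3 / 4 * l) <= _).
      apply: lerD.
        apply: le_trans lLale _; rewrite ler_wpM2l ?mulr_ge0 //.
        by clear - lL0le l1; lra.
      by rewrite ler_wpM2l //; clear - l2le l1; lra.
    by rewrite le_eqVlt; apply/orP; left; apply/eqP; field.
  have a2 : T * (93 / 4 * l) <= 16 / 15 * (tau * L1) * (93 / 4 * l).
    by rewrite ler_wpM2r // mulr_ge0 // ltW.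
  have -> : d * lLa + d * T * l2 = d * (lLa + T * l2) by ring.
  apply: le_trans (ler_wpM2l d0 (le_trans a1 a2)) _.
  have -> : d * (16 / 15 * (tau * L1) * (93 / 4 * l)) = 124 / 5 * y by rewrite /y;
    field.
  by clear - y0; lra.
(* The powers S^D, E^D and L^D; small because L1 l >= 24 W. *)
have c3 : L0 / 2 * (d * lS + l + lam) <= 24 * y.
  have a1 : d * lS + l + lam <= 8 * W.
    have : d * lS <= d * (6 + (l - 1)) by rewrite ler_wpM2l.
    by rewrite mulrDr; clear - WE lW dW; lra.
  apply: le_trans (ler_wpM2l _ a1) _; first by rewrite mulr_ge0.
  have -> : L0 / 2 * (8 * W) = 24 * (d * tau * (24 * W)) by rewrite L0E SE; field.
  by rewrite ler_wpM2l.
have c4 : d * lN + (l - 1) + l3 + l / 2 <= y.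
  have dy : 24 * (15 * d) <= y.
    apply: le_trans ddL; apply: le_trans (_ : L1 * (15 * d) <= _).
      by rewrite ler_wpM2r ?mulr_ge0.
    by rewrite -mulrA ler_peMl ?mulr_ge0.
  have ddy : d * d <= y / 24 / 15.
    have : d * d * 24 <= d * d * L1 by rewrite ler_wpM2l ?mulr_ge0.
    have -> : d * d * L1 = (d * L1 * (15 * d)) / 15 by field.
    by clear - ddL; lra.
  have dty : d * tau <= y / 24.
    have : d * tau * (24 * 1) <= d * tau * (24 * W) by rewrite ler_wpM2l ?mulr_ge0
      ?ler_wpM2l.
    by clear - dtW; lra.
  have dLy : d * L1 <= y / 15.
    have : d * L1 * (15 * 1) <= d * L1 * (15 * d) by rewrite ler_wpM2l ?mulr_ge0
      ?ler_wpM2l.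
    by clear - ddL; lra.
  have : d * lN <= d * (6 + d + tau + L1) by rewrite ler_wpM2l.
  by rewrite !mulrDr; clear - dy ddy dty dLy d1 ld l3le y0; lra.
have {h} : N * ((N - 1) / 2 * l) <= N * ((l - 1) + d * (lLa + lN + T * l2 + L0 / 2 * lS)
   + L1 / 2 * S * (d * l2 + E) + l3 + L0 / 2 * (l + lam)).
  apply: le_trans (_ : N * (N - 1) / 2 * l <= _); first by rewrite !mulrA.
  apply: le_trans h _.
  have X0 : 0 <= d * l2 + E by rewrite addr_ge0 // mulr_ge0.
  have Dle : D <= N * (L0 / 2) by clear - DE N0; lra.
  have Gle : G <= N * (L1 / 2) by clear - GE N0; lra.
  have h1 : d * (D * lS) <= d * (N * (L0 / 2) * lS) by rewrite ler_wpM2l ?ler_wpM2r.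
  have h2 : G * S * (d * l2 + E) <= N * (L1 / 2) * S * (d * l2 + E) by rewrite
    ler_wpM2r // ler_wpM2r.
  have h3 : D * (l + lam) <= N * (L0 / 2) * (l + lam).
    by rewrite ler_wpM2r // addr_ge0 ?(ltW l0) //; clear - lam1; lra.
  have h4 : l - 1 <= N * (l - 1) by rewrite ler_peMl // subr_ge0.
  have -> : N * (l - 1 + d * (lLa + lN + T * l2 + L0 / 2 * lS) + L1 / 2 * S * (d * l2
    + E)
      + l3 + L0 / 2 * (l + lam)) =
    N * (l - 1) + (d * (N * lLa + N * lN + N * T * l2) + d * (N * (L0 / 2) * lS)) +
    N * (L1 / 2) * S * (d * l2 + E) + N * l3 + N * (L0 / 2) * (l + lam) by ring.
  by rewrite [d * (_ + D * lS)]mulrDr !lerD.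
rewrite ler_pM2l // => h.
have e1 : (N - 1) / 2 * l = 72 * y - l / 2.
  have -> : (N - 1) / 2 * l = (N * l) / 2 - l / 2 by field.
  by rewrite yN; field.
have e2 : d * (lLa + lN + T * l2 + L0 / 2 * lS) =
   (d * lLa + d * T * l2) + d * lN + L0 / 2 * (d * lS) by ring.
have e3 : L0 / 2 * (d * lS + l + lam) = L0 / 2 * (d * lS) + L0 / 2 * (l + lam) by ring.
rewrite e1 e2 in h; rewrite e3 in c3; clear - h c1 c2 c3 c4 y0.
set u := L0 / 2 * _ in h c3; set v := L0 / 2 * _ in h c3;
  set w := L1 / 2 * _ * _ in h c1.
lra.
Qed.

End Numeric.

(** * Distance from log 2 to a real root *)

Section RootMeasure.
Variable R : realType.

Definition measure_exponent (d : nat) (L : R) : R :=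
  d%:R ^+ 2 * (ln L + d%:R * ln d%:R) * (1 + ln d%:R)^-1.

Lemma natr_bin2 n : 2 * 'C(n, 2)%:R = n%:R * (n%:R - 1) :> R.
Proof.
case: n => [|n]; first by rewrite bin0n mulr0 mul0r.
have := bin_ffact n.+1 2; rewrite ffactnS ffactn1 /= => /(congr1 (fun k => k%:R : R)).
by rewrite !natrM -[n.+1%:R - 1]/(n.+1%:R - 1%:R) -natrB // subn1 mulrC => ->.
Qed.

Lemma exists_nat_between (x : R) : 0 <= x -> exists n : nat, x <= n%:R <= x + 1.
Proof.
move=> x0; exists (Num.truncn x).+1.
by have /andP[h1 h2] := truncn_itv x0; rewrite ltW //= -natr1 lerD2r.
Qed.

Lemma measure_exponent_facts (d : nat) (L : R) : (0 < d)%N -> 3 <= L ->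
  [/\ 1 <= 1 + ln d%:R :> R, 1 + ln d%:R <= d%:R :> R,
      d%:R <= ln L + d%:R * ln d%:R, 1 + ln d%:R <= ln L + d%:R * ln d%:R & 1 <= ln L].
Proof.
move=> d0 L3; have d1 : (1 : R) <= d%:R by rewrite ler1n.
have dgt0 : (0 : R) < d%:R by rewrite ltr0n.
have l0 : 0 <= ln (d%:R : R) by apply: ln_ge0.
have L1 : 1 <= ln L.
  by apply: le_trans (ln3_ge1 R) _; rewrite ler_ln ?posrE //; apply: lt_le_trans L3.
split=> //.
- by rewrite lerDl.
- by have := ln_le_sub1 dgt0; lra.
- have : d%:R * (1 - d%:R^-1) <= d%:R * ln d%:R :> R by rewrite ler_wpM2l // ln_ge_1Bv.
  by rewrite mulrBr mulr1 divff ?gt_eqF //; lra.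
- by apply: lerD => //; rewrite ler_peMl.
Qed.

Lemma measure_exponent_ge (d : nat) (L : R) : (0 < d)%N -> 3 <= L ->
  d%:R ^+ 2 <= measure_exponent d L.
Proof.
move=> d0 L3; have [l1 ld dW lW _] := measure_exponent_facts d0 L3.
rewrite /measure_exponent -mulrA ler_peMr ?exprn_ge0 // ler_pdivlMr ?mul1r //.
by apply: lt_le_trans l1.
Qed.

Lemma near_ln2 (x : R) : `|ln 2 - x| < 1 / 4 -> x != 0 /\ `|x| <= 1.
Proof.
have := ln2_le R; have := @ln_ge_1Bv R 2 ltac:(by []) => h1 h2.
rewrite ltr_norml => /andP[h3 h4]; split; last by rewrite ler_norml; apply/andP;
  split; lra.
by apply: lt0r_neq0; lra.
Qed.

(** A root that is too close satisfies the hypotheses of [core_inequality] with E = e^l = e d, and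
    its conclusion is refuted by [parameter_inequality]. *)
Lemma real_root_measure (P : {poly int}) (xi L : R) d :
  irreducible_poly P -> size P = d.+1 -> (zpoly_length P)%:~R <= L -> 3 <= L ->
  zpoly_eval P xi = 0 ->
  expR (- (61 * 10 ^+ 3) * measure_exponent d L) <= `|ln 2 - xi|.
Proof.
move=> irrP sP PL L3 Pxi; rewrite leNgt; apply/negP => close.
have d0 : (0 < d)%N by case: irrP; rewrite sP.
have [l1 ld dW lW lam1] := measure_exponent_facts d0 L3.
have q_ge := measure_exponent_ge d0 L3.
have d1 : (1 : R) <= d%:R by rewrite ler1n.
have dgt0 : (0 : R) < d%:R by rewrite ltr0n.
set q := measure_exponent d L in close q_ge.
set l : R := 1 + ln d%:R in l1 ld lW *; set W : R := ln L + _ in dW lW.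
have lgt0 : 0 < l by apply: lt_le_trans l1.
have qE : q = d%:R ^+ 2 * W / l by [].
have q1 : 1 <= q by apply: le_trans q_ge; rewrite exprn_ege1.
have [xi0 xi1] : xi != 0 /\ `|xi| <= 1.
  apply: near_ln2; apply: lt_le_trans close _.
  rewrite mulNr expRN -[1 / 4]invrK lef_pV2 ?posrE ?expR_gt0 //.
  rewrite invf_div divr1; apply: le_trans (expR_ge1Dx _).
  have : 3 * 1 <= 61 * 10 ^+ 3 * q.
    apply: ler_pM => //; apply: le_trans (_ : 61 * 1 <= _); first by clear; lra.
    by rewrite ler_wpM2l // exprn_ege1 // ler1n.
  by clear; lra.
have [tau /andP[tau1 tau2]] := @exists_nat_between (15 * d%:R / l) ltac:(by rewrite
  divr_ge0 ?mulr_ge0 // ltW).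
have W0 : 0 <= W by apply: le_trans dW.
have [L1 /andP[L11 L12]] := @exists_nat_between (24 * W / l) ltac:(by rewrite
  divr_ge0 ?mulr_ge0 // ltW).
have taul : 15 * d%:R <= tau%:R * l by rewrite -ler_pdivrMr.
have taul2 : tau%:R * l <= 16 * d%:R.
  have : tau%:R * l <= (15 * d%:R / l + 1) * l by rewrite ler_pM2r.
  by rewrite mulrDl divfK ?gt_eqF // mul1r; clear - ld; lra.
have L1l : 24 * W <= L1%:R * l by rewrite -ler_pdivrMr.
have L1l2 : L1%:R * l <= 25 * W.
  have : L1%:R * l <= (24 * W / l + 1) * l by rewrite ler_pM2r.
  by rewrite mulrDl divfK ?gt_eqF // mul1r; clear - lW; lra.
have tau0 : (0 < tau)%N.
  rewrite -(ltr0n R) -(pmulr_lgt0 _ lgt0); apply: lt_le_trans taul.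
  by rewrite mulr_gt0.
have L10 : (0 < L1)%N.
  rewrite -(ltr0n R) -(pmulr_lgt0 _ lgt0); apply: lt_le_trans L1l.
  by rewrite mulr_gt0 //; apply: lt_le_trans dW.
(* tau is of size 15 d / l and L1 of size 24 W / l. *)
set S := (12 * 12 * d)%N; set L0 := (S * tau)%N; set T := ((tau + 1) * L1)%N.
have S0 : (0 < S)%N by rewrite !muln_gt0.
have L00 : (0 < L0)%N by rewrite muln_gt0 S0.
set N := (L0 * L1)%N.
have TL1 : (T - L1 = tau * L1)%N by rewrite /T mulnDl mul1n addnK.
have SR : S%:R = 12 * 12 * d%:R :> R by rewrite !natrM.
have L0R : L0%:R = S%:R * tau%:R :> R by rewrite natrM.
have TR : T%:R = (tau%:R + 1) * L1%:R :> R by rewrite natrM natrD.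
have NR : N%:R = L0%:R * L1%:R :> R by rewrite natrM.
have tauR0 : (0 : R) < tau%:R by rewrite ltr0n.
have L1R0 : (0 : R) < L1%:R by rewrite ltr0n.
have lnS : ln S%:R <= 6 + (l - 1).
  rewrite SR !lnM ?posrE ?mulr_gt0 //; have := ln12_le R; rewrite /l; clear; lra.
have lnL0 : ln L0%:R <= 9 + 2 * (l - 1).
  rewrite L0R lnM ?posrE ?ltr0n //.
  have : ln tau%:R <= 3 + (l - 1).
    apply: le_trans (_ : ln (16 * d%:R) <= _).
      rewrite ler_ln ?posrE ?mulr_gt0 //; apply: le_trans taul2.
      by rewrite ler_peMr.
    have -> : (16 : R) = 2 ^+ 4 by rewrite -natrX.
    rewrite lnM ?posrE ?exprn_gt0 // lnXn // -[ln 2 *+ 4]mulr_natl.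
    by have := ln2_le R; rewrite /l; clear; lra.
  by move: lnS; clear; lra.
have lnN : ln N%:R <= 6 + d%:R + tau%:R + L1%:R :> R.
  rewrite NR L0R SR !lnM ?posrE ?mulr_gt0 //.
  have := ln12_le R; have := ln_le_sub1 dgt0; have := ln_le_sub1 tauR0;
    have := ln_le_sub1 L1R0.
  by clear; lra.
(* The origin of 61000: N l <= 144 d (16 d) (25 W / l) = 57600 q <= 60000 q, and log L0 takes at
   most another 1000 q. *)
have near : L0%:R * `|ln 2 - xi| <= (expR l ^+ N)^-1.
  have L0R0 : (0 : R) < L0%:R by rewrite ltr0n.
  rewrite -expRM_natl -expRN -[L0%:R](lnK _) ?posrE //.
  apply: le_trans (ler_wpM2l _ (ltW close)) _; first exact: expR_ge0.
  rewrite -expRD ler_expR.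
  have q0 : 0 <= q by apply: le_trans q1.
  have Nl : N%:R * l <= 60 * 10 ^+ 3 * q.
    have -> : N%:R * l = 12 * 12 * d%:R * (tau%:R * l) * L1%:R by rewrite NR L0R SR;
      ring.
    apply: le_trans (_ : 12 * 12 * d%:R * (16 * d%:R) * (25 * W / l) <= _).
      apply: ler_pM; rewrite ?mulr_ge0 // ?(ltW lgt0) //.
        by rewrite ler_wpM2l // !mulr_ge0.
      by rewrite ler_pdivlMr.
    have -> : 12 * 12 * d%:R * (16 * d%:R) * (25 * W / l) = 12 * 12 * 4 * (10 ^+ 2 * q).
      by rewrite qE; field; rewrite gt_eqF.
    have -> : 60 * 10 ^+ 3 * q = 60 * 10 * (10 ^+ 2 * q) by rewrite exprS; ring.
    apply: ler_wpM2r; first by apply: mulr_ge0.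
    by rewrite -!natrM ler_nat.
  have lq : ln L0%:R <= 10 ^+ 3 * q.
    apply: le_trans lnL0 _; apply: le_trans (_ : 9 * d%:R <= _);
      first by clear - ld d1; lra.
    apply: ler_pM => //; last by apply: le_trans q_ge; rewrite expr2 ler_peMr.
    by apply: le_trans (_ : 10 <= _); rewrite ?ler_nat // ler_eXnr // ler1n.
  have -> : - (61 * 10 ^+ 3) * q = - (60 * 10 ^+ 3 * q + 10 ^+ 3 * q) by ring.
  by rewrite lerBlDl lerBrDr addrC lerD.
have L1T : (0 < L1 < T)%N by rewrite L10 /T mulnDl mul1n -[X in (X < _)%N]add0n
  ltn_add2r muln_gt0 tau0.
(* S (T - L1 + 1) = S tau L1 + S = L0 L1 + S: the choice T = (tau + 1) L1 just meets the condition
   of the zero estimate. *)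
have hS : (L0 * L1 < S * (T - L1).+1)%N by rewrite TL1 mulnS mulnA -[X in (X <
  _)%N]add0n ltn_add2r.
have E1 : 1 <= expR l by rewrite -[leLHS]expR0 ler_expR ltW.
have := core_inequality irrP sP PL Pxi xi0 xi1 E1 L00 L1T hS near erefl erefl erefl.
rewrite expRK -/N.
set D := (L1 * 'C(L0, 2))%N; set G := (L0 * 'C(L1, 2))%N => core.
apply: (@parameter_inequality R d%:R tau%:R L1%:R l W (ln L) (ln S%:R) (ln (prod_lcm
  L0 T)%:R)
  (ln L0%:R) (ln N%:R) (ln 2) (expR l) (ln 3) N%:R L0%:R T%:R S%:R D%:R G%:R);
    rewrite ?l1 ?ld //.
- by rewrite /W /l addrAC subrr add0r.
- by rewrite /D natrM mulrCA natr_bin2 NR; ring.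
- by rewrite /G natrM mulrCA natr_bin2 NR; ring.
- by rewrite lnS ln_ge0 // ler1n.
- apply: le_trans (ln_prod_lcm_le R T L00) _.
  rewrite ler_wpM2r ?addr_ge0 ?ln_ge0 ?ler1n // ler_wpM2r //.
  by have := ln2_le R; clear; lra.
- by rewrite ln2_ge0 ln2_le.
- rewrite expR_ge0 /= /l expRD lnK ?posrE // ler_wpM2r //.
  exact: expR1_le.
- by have := @ln_le_sub1 R 3 ltac:(by []); clear; lra.
- have -> : N%:R * (N%:R - 1) / 2 = 'C(N, 2)%:R :> R by rewrite -natr_bin2 mulrC mulKf.
  have lE : ln d%:R = l - 1 by rewrite /l addrAC subrr add0r.
  by move: core; rewrite lE ![(_ * _)%:R]natrM.
Qed.

End RootMeasure.

(** * From roots to values of polynomials *)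

Section Newton.
Variable R : realType.

Lemma zpoly_length_deriv (P : {poly int}) :
  zpoly_length P^`() <= (size P).-1%:R * zpoly_length P.
Proof.
rewrite {1}/zpoly_length polyorder.size_deriv.
apply: (@le_trans _ _ (\sum_(i < (size P).-1) (size P).-1%:R * `|P`_i.+1|)).
  apply: ler_sum => i _; rewrite coef_deriv normrMn -[_ *+ _]mulr_natl.
  by rewrite ler_wpM2r // ler_nat.
rewrite -mulr_sumr ler_wpM2l //; apply: le_trans (sum_norm_coef_le P (size P).-1.+1).
by rewrite big_ord_recl lerDr.
Qed.

Lemma monomial_taylor_le (x u : R) k : `|x| <= 1 -> `|x + u| <= 1 ->
  `|(x + u) ^+ k - x ^+ k - u * x ^+ k.-1 *+ k| <= k%:R ^+ 2 * u ^+ 2.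
Proof.
move=> x1 xu1; elim: k => [|k IH];
  first by rewrite !expr0 mulr0n subrr subr0 normr0 mulr_ge0 ?sqr_ge0.
have -> : (x + u) ^+ k.+1 - x ^+ k.+1 - u * x ^+ k.+1.-1 *+ k.+1 =
  (x + u) * ((x + u) ^+ k - x ^+ k - u * x ^+ k.-1 *+ k) + u ^+ 2 * (x ^+ k.-1 *+ k).
  case: k {IH} => [|k]; rewrite /=; first by ring.
  by rewrite !exprS; move: (x ^+ k) ((x + u) ^+ k) => a b; ring.
apply: le_trans (ler_normD _ _) _; rewrite normrM.
apply: le_trans (_ : k%:R ^+ 2 * u ^+ 2 + k%:R * u ^+ 2 <= _).
  apply: lerD; first by apply: le_trans (ler_piMl _ xu1) IH.
  rewrite normrM normrX real_normK ?num_real // mulrC ler_wpM2r ?sqr_ge0 //.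
  by rewrite normrMn normrX -[`|x| ^+ _ *+ k]mulr_natr ler_piMl // exprn_ile1.
rewrite -mulrDl ler_wpM2r ?sqr_ge0 // -natr1.
have k0 : (0 : R) <= k%:R by [].
rewrite !expr2; clear - k0; nra.
Qed.

Lemma zpoly_taylor_le (P : {poly int}) (x u : R) : `|x| <= 1 -> `|x + u| <= 1 ->
  `|zpoly_eval P (x + u) - zpoly_eval P x - u * zpoly_eval P^`() x| <=
  (size P).-1%:R ^+ 2 * (zpoly_length P)%:~R * u ^+ 2.
Proof.
move=> x1 xu1; rewrite /zpoly_eval -deriv_map; set p := map_poly intr P.
have pE : p = \sum_(i < size P) (P`_i)%:~R *: 'X^i.
  by rewrite /p /map_poly poly_def.
have -> : p.[x + u] - p.[x] - u * p^`().[x] =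
    \sum_(k < size P) (P`_k)%:~R * ((x + u) ^+ k - x ^+ k - u * x ^+ k.-1 *+ k).
  rewrite {}pE raddf_sum /= !horner_sum -sumrB mulr_sumr -sumrB; apply: eq_bigr => k _.
  rewrite derivZ derivXn !hornerZ hornerMn !hornerXn.
  by move: ((x + u) ^+ k) (x ^+ k) (x ^+ k.-1) => a b c; ring.
apply: le_trans (ler_norm_sum _ _ _) _.
rewrite /zpoly_length rmorph_sum /= mulr_sumr mulr_suml; apply: ler_sum => k _.
rewrite normrM intr_norm [leRHS]mulrAC [leRHS]mulrC ler_wpM2l //.
apply: le_trans (monomial_taylor_le _ x1 xu1) _.
rewrite ler_wpM2r ?sqr_ge0 //; apply: lerXn2r; rewrite ?nnegrE // ler_nat.
by rewrite -ltnS prednK // (leq_ltn_trans _ (ltn_ord k)).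
Qed.

(** The resultant of P and P' prevents both from being small at log 2. If P is small, the derivative
    is not, and a second-order Taylor estimate yields a real root close enough to contradict
    [real_root_measure]; losing powers of B costs less than 1000 q. *)
Lemma irreducible_eval_measure (P : {poly int}) (L : R) d :
  irreducible_poly P -> size P = d.+1 -> (zpoly_length P)%:~R <= L -> 3 <= L ->
  expR (- (62 * 10 ^+ 3) * measure_exponent d L) <= `|zpoly_eval P (ln 2)|.
Proof.
move=> irrP sP PL L3; rewrite leNgt; apply/negP => small.
have d0 : (0 < d)%N by case: irrP; rewrite sP.
have [l1 ld dW lW lam1] := measure_exponent_facts d0 L3.
have q_ge := measure_exponent_ge d0 L3.
have d1 : (1 : R) <= d%:R by rewrite ler1n.
have dgt0 : (0 : R) < d%:R by rewrite ltr0n.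
have Lgt0 : 0 < L by apply: lt_le_trans L3.
have L1 : 1 <= L by apply: le_trans L3; clear; lra.
set x : R := ln 2 in small *; set f := zpoly_eval P x in small *.
have [x1 x2] : 1 / 2 <= x /\ x <= 3 / 4.
  by split; [have := @ln_ge_1Bv R 2 ltac:(by []); rewrite -/x; clear;
    lra|exact: ln2_le].
have x01 : `|x| <= 1 by rewrite ger0_norm; clear - x1 x2; lra.
(* B bounds all factors in the resultant inequality for P and P', since L(P') <= d L; it is at most
   e^(2q). *)
pose B : R := d%:R * L ^+ d * (d%:R * L) ^+ d.
have sP' : size P^`() = d.-1.+1 by rewrite polyorder.size_deriv sP prednK.
have P'0 : P^`() != 0 by rewrite -size_poly_eq0 sP'.
have cPP' : coprimep P P^`().
  rewrite coprimep_def; apply: contraT => g1; have [_ irr] := irrP.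
  have : P %| P^`() by rewrite -(eqp_dvdl _ (irr _ g1 (dvdp_gcdl _ _))) dvdp_gcdr.
  by move/(dvdp_leq P'0); rewrite sP' sP prednK // ltnn.
have PP0 : P != 0 by rewrite -size_poly_eq0 sP.
have lP1 : (1 : R) <= (zpoly_length P)%:~R by rewrite -[1]/(1%:~R) ler_int
  zpoly_length_ge1.
have lP0 : (0 : R) <= (zpoly_length P)%:~R by apply: le_trans lP1.
have lP'0 : (0 : R) <= (zpoly_length P^`())%:~R by rewrite ler0z zpoly_length_ge0.
have dL1 : 1 <= d%:R * L by rewrite -[leLHS]mulr1 ler_pM.
have lP' : (zpoly_length P^`())%:~R <= d%:R * L.
  apply: le_trans (_ : d%:R * (zpoly_length P)%:~R <= _); last by rewrite ler_wpM2l.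
  have := zpoly_length_deriv P; rewrite sP /= -(ler_int R) => /le_trans; apply.
  by rewrite rmorphM /= rmorph_nat.
have B1 : 1 <= B.
  rewrite /B -[leLHS]mulr1 ler_pM ?exprn_ege1 //.
  by rewrite -[leLHS]mulr1 ler_pM ?exprn_ege1.
have B0 : 0 < B by apply: lt_le_trans B1.
have res : 1 <= B * `|f| + B * `|zpoly_eval P^`() x|.
  have := coprimep_eval_ge cPP' sP sP' d0 x01; rewrite -/f => /le_trans; apply.
  have bound k m (a e : nat) : (k <= d)%N -> (a <= d)%N -> (e <= d)%N -> 0 <= m ->
    k%:R * m * (zpoly_length P)%:~R ^+ a * (zpoly_length P^`())%:~R ^+ e <= B * m.
    move=> kd ad ed m0; have -> : B * m = d%:R * m * L ^+ d * (d%:R * L) ^+ d by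
      rewrite /B; ring.
    apply: ler_pM; rewrite ?mulr_ge0 ?exprn_ge0 //.
      apply: ler_pM; rewrite ?mulr_ge0 ?exprn_ge0 //.
        by rewrite ler_wpM2r // ler_nat.
      apply: le_trans (_ : L ^+ a <= _); last exact: ler_weXn2l.
      by apply: lerXn2r; rewrite ?nnegrE // ltW.
    apply: le_trans (_ : (d%:R * L) ^+ e <= _); last exact: ler_weXn2l.
    by apply: lerXn2r; rewrite ?nnegrE // (le_trans ler01).
  by apply: lerD; apply: bound => //; clear; lia.
set q := measure_exponent d L in small q_ge.
have q1 : 1 <= q by apply: le_trans q_ge; rewrite exprn_ege1.
have BE : B <= expR (2 * q).
  have dWq : d%:R * (ln L + d%:R * ln d%:R) <= q.
    rewrite /q /measure_exponent expr2 -!mulrA ler_wpM2l //.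
    rewrite mulrA mulrAC; set W := _ + _ in dW *.
    have W0 : 0 <= W by apply: le_trans dW; apply: ltW.
    rewrite mulrC -[leLHS]mulr1 ler_wpM2l // ler_pdivlMr ?mul1r //.
    by apply: lt_le_trans l1.
  rewrite -[B](lnK _) ?posrE // ler_expR.
  rewrite /B !lnM ?posrE ?mulr_gt0 ?exprn_gt0 ?mulr_gt0 // !lnXn ?mulr_gt0 // lnM
    ?posrE //.
  have lnd : 0 <= ln (d%:R : R) by apply: ln_ge0.
  have h1 : ln (d%:R : R) <= d%:R * ln d%:R by rewrite ler_peMl.
  have h2 : d%:R * ln d%:R <= d%:R * (d%:R * ln d%:R) :> R by rewrite ler_peMl //
    mulr_ge0.
  move: dWq; rewrite -[ln L *+ d]mulr_natl -[(_ + _) *+ d]mulr_natl !mulrDr.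
  by move: h1 h2; clear; lra.
have dB : d%:R ^+ 2 * (zpoly_length P)%:~R <= B.
  rewrite /B expr2 -[leLHS]mulrA -[leRHS]mulrA ler_wpM2l // -[leLHS]mul1r.
  apply: ler_pM; rewrite ?mulr_ge0 ?exprn_ege1 //.
  by apply: le_trans (ler_wpM2l _ PL) _; rewrite // ler_eXnr.
clearbody B.
set F := `|f| in small res *.
have F0 : 0 <= F by apply: normr_ge0.
have tiny : expR (10 * q) * F <= expR (- (61 * 10 ^+ 3) * q).
  apply: le_trans (ler_wpM2l _ (ltW small)) _; first exact: expR_ge0.
  rewrite -expRD ler_expR.
  have : 10 * q <= 10 ^+ 3 * q.
    by rewrite ler_wpM2r ?(le_trans ler01) // ler_eXnr // ler1n.
  have -> : - (62 * 10 ^+ 3) * q = - (61 * 10 ^+ 3) * q - 10 ^+ 3 * q by ring.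
  by set a := 10 ^+ 3 * q; set b := _ * q; set c := 10 * q; clear; lra.
have B3 : 16 * B ^+ 3 <= expR (10 * q).
  have -> : 10 * q = 4 * q + 3%:R * (2 * q) by ring.
  rewrite expRD; apply: ler_pM; rewrite ?exprn_ge0 ?(ltW B0) //; last first.
    by rewrite expRM_natl; apply: lerXn2r; rewrite ?nnegrE ?expR_ge0 ?(ltW B0).
  apply: le_trans (_ : expR 1 ^+ 4 <= _); last first.
    by rewrite -expRM_natl ler_expR mulr1 ler_peMr.
  apply: le_trans (_ : (5 / 2) ^+ 4 <= _); first by rewrite !exprS expr0; clear; lra.
  by apply: lerXn2r; rewrite ?nnegrE ?expR_ge0 ?expR1_ge //; clear; lra.
have BF : 16 * B ^+ 3 * F <= expR (- (61 * 10 ^+ 3) * q).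
  by apply: le_trans tiny; rewrite ler_wpM2r.
have exp_le1 : expR (- (61 * 10 ^+ 3) * q) <= 1.
  rewrite -[leRHS]expR0 ler_expR mulNr oppr_le0; apply: mulr_ge0;
    last exact: le_trans q1.
  by apply: mulr_ge0 => //; apply: exprn_ge0.
have BF1 : 4 * B * F <= 1 / 4 * expR (- (61 * 10 ^+ 3) * q).
  apply: le_trans (_ : 1 / 4 * (16 * B ^+ 3 * F) <= _); last by rewrite ler_wpM2l.
  have -> : 1 / 4 * (16 * B ^+ 3 * F) = 4 * B * F * B ^+ 2 by rewrite !exprS; field.
  by rewrite ler_peMr ?mulr_ge0 ?(ltW B0) // exprn_ege1.
(* The radius in which the root is sought: B |f'| >= 1/2 gives |f'| h >= 2 F, and h is at most a
   quarter of the distance excluded by [real_root_measure]. *)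
pose h := 4 * B * F.
have h0 : 0 <= h by rewrite !mulr_ge0 // ltW.
have h14 : h <= 1 / 4 by apply: le_trans BF1 _; clear - exp_le1; lra.
set f' := zpoly_eval _ _ in res.
have f'h : 2 * F <= `|f'| * h.
  have : 1 / 2 <= B * `|f'| by move: h14 res; rewrite /h -mulrA; clear; lra.
  have -> : `|f'| * h = 4 * F * (B * `|f'|) by rewrite /h; ring.
  move=> hh; apply: le_trans (ler_wpM2l _ hh); last by rewrite mulr_ge0.
  by rewrite le_eqVlt; apply/orP; left; apply/eqP; field.
(* The Taylor remainder is at most B h^2 = (16 B^3 F) F, and the bracket is at most 1. *)
have rem u : `|u| = h -> `|zpoly_eval P (x + u) - f - u * f'| <= F.
  move=> uh; apply: le_trans (zpoly_taylor_le _ x01 _) _.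
    have : - h <= u <= h by rewrite -ler_norml uh.
    by rewrite ler_norml => /andP[u1 u2]; apply/andP; split; clear - u1 u2 x1 x2 h14;
      lra.
  rewrite sP /= -[u ^+ 2]real_normK ?num_real // uh.
  apply: le_trans (ler_wpM2r _ dB) _; first exact: exprn_ge0.
  have -> : B * h ^+ 2 = (16 * B ^+ 3 * F) * F by rewrite /h; ring.
  by rewrite ler_piMl // (le_trans BF).
(* P changes sign between x - h and x + h, since |f'| h >= 2 |f|. *)
have [xi xxi rxi] : exists2 xi, `|x - xi| <= h & zpoly_eval P xi = 0.
  have hh : x + - h <= x + h by rewrite lerD2l; clear - h0; lra.
  have near_root xi : x + - h <= xi <= x + h -> `|x - xi| <= h.
    by rewrite ler_norml => /andP[a1 a2]; apply/andP; split; clear - a1 a2; lra.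
  have fF : - F <= f <= F by rewrite -ler_norml.
  have := rem h (ger0_norm h0); have := rem (- h);
    rewrite normrN ger0_norm // => /(_ erefl).
  rewrite !ler_norml !mulNr mulrC => /andP[m1 m2] /andP[p1 p2].
  move: fF f'h m1 m2 p1 p2; have [f'0|f'0] := lerP 0 f'.
    rewrite ger0_norm // => /andP[f1 f2] k1 m1 m2 p1 p2.
    have [|xi xiI /rootP rxi] := @poly_ivt R (map_poly intr P) (x + - h) (x + h) hh.
      by apply/andP; split; move: f1 f2 k1 m1 m2 p1 p2; rewrite /zpoly_eval; clear; lra.
    by exists xi => //; apply: near_root.
  rewrite ltr0_norm // mulNr => /andP[f1 f2] k1 m1 m2 p1 p2.
  have [|xi xiI /rootP rxi] := @poly_ivt R (- map_poly intr P) (x + - h) (x + h) hh.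
    by rewrite !hornerN; apply/andP; split; move: f1 f2 k1 m1 m2 p1 p2;
      rewrite /zpoly_eval; clear; lra.
  exists xi; first exact: near_root.
  by apply/eqP; rewrite -oppr_eq0 -hornerN rxi.
have := real_root_measure irrP sP PL L3 rxi; rewrite -/x -/q => hxi.
have : expR (- (61 * 10 ^+ 3) * q) <= 1 / 4 * expR (- (61 * 10 ^+ 3) * q).
  by apply: le_trans hxi _; apply: le_trans xxi _.
have := expR_gt0 (- (61 * 10 ^+ 3) * q); set e := expR _; clear; lra.
Qed.

End Newton.

(** * Mahler measure and length *)

Section Landau.
Variable C : numClosedFieldType.
Implicit Types (p q : {poly C}) (r : seq C).

(* Replacing z by its reflection in the unit circle preserves the sum of the   *)
(* squares of the coefficients, and moves all roots into the unit disc.        *)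
Definition reflected_factor (z : C) : {poly C} :=
  if `|z| <= 1 then 'X - z%:P else z^* *: 'X - 1.

Definition max1 (z : C) : C := if `|z| <= 1 then 1 else `|z|.

Lemma max1_gt0 z : 0 < max1 z.
Proof.
rewrite /max1; case: ifP => // /negbT; rewrite -real_ltNge ?real1 ?normr_real //.
exact: lt_trans.
Qed.

Lemma coef_mul_linear p (a b : C) i :
  (p * (a *: 'X - b%:P))`_i = (if i is j.+1 then a * p`_j else 0) - b * p`_i.
Proof.
rewrite mulrBr -scalerAr coefB coefZ coefMX coefMC [p`_i * b]mulrC.
by case: i => [|i] //=; rewrite mulr0.
Qed.

(** The squared coefficients of index i differ by (1 - |z|^2) (|p_(i-1)|^2 - |p_i|^2), and the sum
    of these differences telescopes to 0. *)
Lemma sum_sqr_norm_reflect p n z : (size p < n)%N ->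
  \sum_(i < n) `|(p * ('X - z%:P))`_i| ^+ 2 =
  \sum_(i < n) `|(p * (z^* *: 'X - 1))`_i| ^+ 2.
Proof.
case: n => // n; rewrite ltnS => pn; apply/eqP; rewrite -subr_eq0 -sumrB; apply/eqP.
pose u i := if i is j.+1 then `|p`_j| ^+ 2 else 0.
rewrite (eq_bigr (fun i : 'I_n.+1 => (1 - `|z| ^+ 2) * (u i - u i.+1))) => [|i _].
  rewrite -mulr_sumr -(big_mkord xpredT (fun i => u i - u i.+1)).
  under eq_bigr do rewrite -opprB.
  rewrite sumrN telescope_sumr //= nth_default // normr0 expr0n subrr oppr0 mulr0 //.
have -> : 'X - z%:P = 1 *: 'X - z%:P by rewrite scale1r.
have -> : z^* *: 'X - 1 = z^* *: 'X - 1%:P by rewrite polyC1.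
rewrite !coef_mul_linear.
by case: (nat_of_ord i) => [|j];
  rewrite /u !normCK !(rmorphB, rmorphM, rmorph0, rmorph1) /= ?conjCK; ring.
Qed.

Lemma size_reflected_factor z : (size (reflected_factor z) <= 2)%N.
Proof.
rewrite /reflected_factor; case: ifP => _; first by rewrite size_XsubC.
apply: leq_trans (size_polyD _ _) _; rewrite geq_max size_polyN size_poly1 andbT.
by rewrite (leq_trans (size_scale_leq _ _)) // size_polyX.
Qed.

Lemma size_prod_reflected_factor r :
  (size (\prod_(z <- r) reflected_factor z)%R <= (size r).+1)%N.
Proof.
elim: r => [|z r IH]; first by rewrite big_nil size_poly1.
rewrite big_cons; apply: leq_trans (size_polyMleq _ _) _.
have h a b c : (a <= 2 -> b <= c.+1 -> (a + b).-1 <= c.+2)%N by lia.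
exact: h (size_reflected_factor z) IH.
Qed.

Lemma sum_sqr_norm_reflects q r n : (size q + size r < n)%N ->
  \sum_(i < n) `|(q * \prod_(z <- r) ('X - z%:P))`_i| ^+ 2 =
  \sum_(i < n) `|(q * \prod_(z <- r) reflected_factor z)`_i| ^+ 2.
Proof.
elim: r q => [|z r IH] q sn; first by rewrite !big_nil.
rewrite !big_cons !mulrA /= in sn *.
have s2 (g : {poly C}) : (size g <= 2)%N -> (size (q * g)%R + size r < n)%N.
  move=> g2; apply: leq_ltn_trans sn; rewrite addnS -addSn leq_add2r.
  have h a b : (b <= 2 -> (a + b).-1 <= a.+1)%N by lia.
  by apply: leq_trans (size_polyMleq _ _) _; apply: h.
rewrite -[RHS]IH ?s2 ?size_reflected_factor // /reflected_factor; case: ifP => // _.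
rewrite -!mulrA [('X - _) * _]mulrC [(_ - 1) * _]mulrC !mulrA.
apply: sum_sqr_norm_reflect; apply: leq_ltn_trans (size_polyMleq _ _) _.
by rewrite size_prod_XsubC (leq_ltn_trans (leq_pred _) sn).
Qed.

Lemma lead_coef_reflected (c : C) r :
  `|lead_coef (c%:P * \prod_(z <- r) reflected_factor z)| = `|c| * \prod_(z <- r)
    max1 z.
Proof.
rewrite lead_coefM lead_coefC normrM; congr (_ * _).
elim: r => [|z r IH]; first by rewrite !big_nil lead_coef1 normr1.
rewrite !big_cons lead_coefM normrM IH; congr (_ * _).
rewrite /reflected_factor /max1; case: ifP => z1.
  by rewrite lead_coefXsubC normr1.
have z0 : z^* != 0 by rewrite conjC_eq0; apply: contraFneq z1 => ->;
  rewrite normr0 ler01.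
by rewrite lead_coefDl ?lead_coefZ ?lead_coefX ?mulr1 ?norm_conjC // size_scale //
  size_polyX size_polyN size_poly1.
Qed.

(** Landau's inequality: the left side is the absolute value of the leading coefficient of the
    reflected polynomial, so its square is at most the sum of the squared coefficients, which
    reflection preserves, and that sum is at most the squared length. *)
Lemma mahler_le_length (c : C) r n : ((size r).+2 < n)%N ->
  `|c| * \prod_(z <- r) max1 z <= \sum_(i < n) `|(c%:P * \prod_(z <- r) ('X -
    z%:P))`_i|.
Proof.
move=> rn; set M := _ * _; set p := _ * _.
have M0 : 0 <= M by rewrite mulr_ge0 // prodr_ge0 // => z _; rewrite ltW ?max1_gt0.
have S0 : 0 <= \sum_(i < n) `|p`_i| by apply: sumr_ge0.
rewrite -(@ler_pXn2r _ 2) ?nnegrE //.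
apply: le_trans (_ : \sum_(i < n) `|p`_i| ^+ 2 <= _); last first.
  rewrite expr2 mulr_suml; apply: ler_sum => i _; rewrite expr2 ler_wpM2l //.
  by rewrite (bigD1 i) //= lerDl sumr_ge0.
rewrite sum_sqr_norm_reflects; last first.
  by apply: leq_ltn_trans rn;
    rewrite -addn2 addnC leq_add2l (leq_trans (size_polyC_leq1 c)).
rewrite /M -lead_coef_reflected lead_coefE; set q := _ * _.
have [q0|q0] := eqVneq (size q) 0;
  first by rewrite q0 nth_default ?q0 // normr0 expr0n sumr_ge0 // => i _;
    rewrite exprn_ge0.
have sq : ((size q).-1 < n)%N.
  rewrite prednK ?lt0n //; apply: leq_trans (size_polyMleq _ _) _.
  have h a b k : (a <= 1 -> b <= k.+1 -> k.+2 < n -> (a + b).-1 <= n)%N by lia.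
  exact: h (size_polyC_leq1 c) (size_prod_reflected_factor r) rn.
by rewrite (bigD1 (Ordinal sq)) //= lerDl sumr_ge0 // => i _; rewrite exprn_ge0.
Qed.

(** Each factor X - z multiplies the length by at most 1 + |z| <= 2 max(1, |z|). *)
Lemma length_le_mahler (c : C) r :
  \sum_(i < (size r).+1) `|(c%:P * \prod_(z <- r) ('X - z%:P))`_i| <=
  2 ^+ size r * (`|c| * \prod_(z <- r) max1 z).
Proof.
elim: r c => [|z r IH] c.
  by rewrite big_ord1 !big_nil !mulr1 coefC expr0 mul1r.
set p := c%:P * \prod_(z <- r) ('X - z%:P).
rewrite !big_cons mulrCA mulrC -/p /=.
have -> : 'X - z%:P = 1 *: 'X - z%:P by rewrite scale1r.
have sp : p`_(size r).+1 = 0.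
  rewrite nth_default //; apply: leq_trans (size_polyMleq _ _) _.
  by rewrite size_prod_XsubC addnS /= -add1n leq_add2r size_polyC_leq1.
apply: le_trans (_ : (1 + `|z|) * \sum_(i < (size r).+1) `|p`_i| <= _).
  rewrite mulrDl mul1r.
  apply: (@le_trans _ _ (\sum_(i < (size r).+2) ((if i : nat is j.+1 then `|p`_j|
    else 0) + `|z| * `|p`_i|))).
    apply: ler_sum => i _; rewrite coef_mul_linear (le_trans (ler_normB _ _)) //.
    rewrite normrM lerD2r; case: (nat_of_ord i) => [|j]; first by rewrite normr0.
    by rewrite mul1r.
  rewrite big_split /= -mulr_sumr big_ord_recl add0r lerD2l big_ord_recr /= sp normr0
    addr0.
  by [].
have -> : 2 ^+ (size r).+1 * (`|c| * (max1 z * \prod_(z <- r) max1 z)) =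
   (2 * max1 z) * (2 ^+ size r * (`|c| * \prod_(z <- r) max1 z)) by rewrite exprS; ring.
apply: ler_pM; [by rewrite addr_ge0|exact: sumr_ge0| |exact: IH]; rewrite /max1.
case: ifP => z1; first by rewrite mulr1 -[leRHS]/(1 + 1) lerD2l.
rewrite mulr_natl mulr2n lerD2r ltW //.
by move/negbT: z1; rewrite -real_ltNge ?real1 ?normr_real.
Qed.

End Landau.

(** The Mahler measure is multiplicative: each length is at most 2^deg times the measure of its
    factor, and the measure of the product is at most its length. *)
Lemma prod_zpoly_length_le (ps : seq {poly int}) : all (predC1 0) ps ->
  \prod_(P <- ps) zpoly_length P <=
  2 ^+ (\sum_(P <- ps) (size P).-1)%N * zpoly_length (\prod_(P <- ps) P).
Proof.
move=> ps0.
have [c [r [pE rE lenE]]] : exists c (r : seq algC),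
  [/\ map_poly intr (\prod_(P <- ps) P) = c%:P * \prod_(z <- r) ('X - z%:P),
      size r = (\sum_(P <- ps) (size P).-1)%N &
      (\prod_(P <- ps) zpoly_length P)%:~R <= 2 ^+ size r * (`|c| * \prod_(z <- r)
        max1 z)].
  elim: ps ps0 => [_|P ps IH /= /andP[P0 /IH [c [r [pE rE lenE]]]]].
    by exists 1, [::]; rewrite !big_nil rmorph1 polyC1 mulr1 normr1 !mulr1.
  have [r' r'E] := closed_field_poly_normal (map_poly intr P : {poly algC}).
  move: r'E; rewrite -mul_polyC; set c' := lead_coef _ => r'E.
  have sP : size (map_poly intr P : {poly algC}) = size P.
    by apply: size_map_inj_poly => //; apply: intr_inj.
  have c'0 : c' != 0 by rewrite lead_coef_eq0 -size_poly_eq0 sP size_poly_eq0.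
  have sr' : size r' = (size P).-1.
    have := sP; rewrite {1}r'E mul_polyC size_scale // size_prod_XsubC => <-.
    by [].
  exists (c * c'), (r ++ r'); rewrite !big_cons !big_cat /= !size_cat; split.
  - by rewrite rmorphM /= pE r'E polyCM; ring.
  - by rewrite rE sr' addnC.
  rewrite rmorphM /= normrM exprD.
  have len' := length_le_mahler c' r'.
  have -> : 2 ^+ size r * 2 ^+ size r' * (`|c| * `|c'| * (\prod_(i <- r) max1 i *
    \prod_(i <- r') max1 i)) =
     (2 ^+ size r' * (`|c'| * \prod_(i <- r') max1 i)) * (2 ^+ size r * (`|c| *
       \prod_(i <- r) max1 i)) by ring.
  apply: ler_pM => //; rewrite ?ler0z ?zpoly_length_ge0 ?prodr_ge0 // => *;
    rewrite ?zpoly_length_ge0 //.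
  apply: le_trans len';
    rewrite -r'E sr' prednK ?size_poly_gt0 // /zpoly_length rmorph_sum /=.
  by rewrite le_eqVlt; apply/orP; left; apply/eqP; apply: eq_bigr => i _;
    rewrite coef_map intr_norm.
rewrite -(ler_int algC); apply: le_trans lenE _; rewrite rmorphM rmorphXn /= rE.
rewrite ler_wpM2l ?exprn_ge0 //; apply: le_trans (mahler_le_length c (ltnSn _)) _.
rewrite -pE; set Q := \prod_(P <- ps) P.
apply: le_trans (_ : (\sum_(i < (size r).+3) `|Q`_i|)%:~R <= _); last first.
  by rewrite ler_int sum_norm_coef_le.
rewrite rmorph_sum /=; apply: ler_sum => i _; by rewrite coef_map intr_norm.
Qed.

(** * Reduction of the general case to irreducible factors *)

Lemma zpoly_factorization (P : {poly int}) : P != 0 ->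
  exists (c : int) (ps : seq {poly int}), [/\ c != 0,
    {in ps, forall Q, irreducible_poly Q} & P = c%:P * \prod_(Q <- ps) Q].
Proof.
have [n] := ubnP (size P); elim: n P => // n IH P Pn P0.
have [sP|sP] := leqP (size P) 1.
  exists P`_0, [::]; split=> //; last by rewrite big_nil mulr1; apply: size1_polyC.
  by apply: contraNneq P0 => c0; rewrite (size1_polyC sP) c0.
have [irrP|redP] := pselect (irreducible_poly P).
  exists 1, [:: P]; split; rewrite ?big_seq1 ?mul1r //.
  by move=> Q; rewrite inE => /eqP ->.
have [q [sq qP nqP]] : exists q : {poly int}, [/\ size q != 1, q %| P & ~~ (q %= P)].
  apply: contrapT => H; apply: redP; split=> // q sq qP; apply: contrapT => /negP nqP.
  by apply: H; exists q.
(* Gauss's lemma: the cofactor of the primitive part of q has integer coefficients. *)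
have [r PE] := dvdpP_int qP.
have q0 : q != 0 by apply: contraTneq qP => ->; rewrite dvd0p.
have r0 : r != 0 by apply: contraNneq P0 => r0; rewrite PE r0 mulr0.
have zq0 : zprimitive q != 0 by rewrite zprimitive_eq0.
have szq : size (zprimitive q) = size q by rewrite size_zprimitive.
have sq1 : (1 < size q)%N by rewrite ltn_neqAle eq_sym sq size_poly_gt0.
have sqP : (size q < size P)%N.
  by rewrite ltn_neqAle dvdp_leq // andbT dvdp_size_eqp.
have sr : (size r < size P)%N.
  rewrite PE size_mul // szq -subn1 -addnBAC ?(ltnW sq1) // subn1.
  by rewrite -[X in (X < _)%N]add0n ltn_add2r -subn1 subn_gt0.
have [c1 [ps1 [c10 irr1 E1]]] : exists (c : int) (ps : seq {poly int}), [/\ c != 0,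
    {in ps, forall Q, irreducible_poly Q} & zprimitive q = c%:P * \prod_(Q <- ps) Q].
  by apply: IH => //; rewrite szq (leq_trans sqP).
have [c2 [ps2 [c20 irr2 E2]]] := IH r (leq_trans sr Pn) r0.
exists (c1 * c2), (ps1 ++ ps2); split; first by rewrite mulf_neq0.
  by move=> Q; rewrite mem_cat => /orP[/irr1|/irr2].
by rewrite PE E1 E2 big_cat polyCM mulrACA.
Qed.

Section Main.
Variable R : realType.

(** Cleared of denominators, this follows from a^2 log(b/a) <= a (b - a) <= b^2 - a^2. It serves to
    replace the degree of a factor by d. *)
Lemma sqr_div_1Dln_le (a b : R) : 1 <= a -> a <= b ->
  a ^+ 2 / (1 + ln a) <= b ^+ 2 / (1 + ln b).
Proof.
move=> a1 ab; have a0 : 0 < a by apply: lt_le_trans a1.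
have b0 : 0 < b by apply: lt_le_trans ab.
have la : 0 <= ln a by apply: ln_ge0.
have lb : 0 <= ln b by apply: ln_ge0; apply: le_trans ab.
rewrite ler_pdivrMr ?ltr_wpDr // mulrAC ler_pdivlMr ?ltr_wpDr //.
have lab : a * (ln b - ln a) <= b - a.
  have := @ln_le_sub1 R (b / a); rewrite divr_gt0 // ln_div ?posrE // => /(_ isT) h.
  by apply: le_trans (ler_wpM2l (ltW a0) h) _;
    rewrite mulrBr mulr1 mulrCA divff ?mulr1 ?gt_eqF.
have h1 : a * (a * (ln b - ln a)) <= a * (b - a) by rewrite ler_wpM2l ?(ltW a0).
have h2 : a * (b - a) <= (b + a) * (b - a).
  by rewrite ler_wpM2r ?subr_ge0 // lerDr (ltW b0).
have h3 : 0 <= (b + a) * (b - a) * ln a by rewrite !mulr_ge0 ?subr_ge0 // addr_ge0 //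
  ltW.
rewrite -subr_ge0.
have -> : b ^+ 2 * (1 + ln a) - a ^+ 2 * (1 + ln b) =
  ((b + a) * (b - a) - a * (a * (ln b - ln a))) + (b + a) * (b - a) * ln a by ring.
by rewrite addr_ge0 // subr_ge0 (le_trans h1).
Qed.

(** The factor d^2 / (1 + log d) is made common to all irreducible factors by monotonicity, so that
    the remaining quantities, log lengths and degrees, are additive over the factorization. *)
Lemma prod_eval_measure (ps : seq {poly int}) d : (0 < d)%N ->
  {in ps, forall Q, irreducible_poly Q} -> (\sum_(Q <- ps) (size Q).-1 <= d)%N ->
  expR (- (62 * 10 ^+ 3) * (d%:R ^+ 2 / (1 + ln d%:R) *
     (\sum_(Q <- ps) (ln 3 + ln (zpoly_length Q)%:~R + (size Q).-1%:R * ln d%:R))))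
  <= `|\prod_(Q <- ps) zpoly_eval Q (ln 2)| :> R.
Proof.
move=> d0; elim: ps => [|P ps IH] irr sd.
  by rewrite !big_nil mulr0 mulr0 expR0 normr1.
rewrite !big_cons /= in sd *; set k := (size P).-1 in sd *.
have irrP : irreducible_poly P by apply: irr; rewrite mem_head.
have k0 : (0 < k)%N by rewrite /k -subn1 subn_gt0; case: irrP.
have sP : size P = k.+1 by rewrite prednK //; case: irrP => /ltnW.
have P0 : P != 0 by rewrite -size_poly_eq0 sP.
have kd : (k <= d)%N by apply: leq_trans sd; rewrite leq_addr.
rewrite normrM 2!mulrDr expRD; apply: ler_pM; rewrite ?expR_ge0 //; last first.
  apply: IH; first by move=> Q Qps; apply: irr; rewrite inE Qps orbT.
  by apply: leq_trans sd; rewrite leq_addl.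
set len : R := (zpoly_length P)%:~R.
have len1 : 1 <= len by rewrite -[1]/(1%:~R) ler_int zpoly_length_ge1.
have len0 : 0 < len by apply: lt_le_trans len1.
(* The measure requires a length bound of at least 3; three times the length meets it, at the price
   of log 3 per factor. *)
have lenL : len <= 3 * len by rewrite ler_peMl ?(ltW len0) // ler1n.
have L3 : 3 <= 3 * len by rewrite ler_peMr.
apply: le_trans (irreducible_eval_measure irrP sP lenL L3).
rewrite ler_expR !mulNr lerN2 ler_wpM2l ?mulr_ge0 ?exprn_ge0 //.
rewrite /measure_exponent lnM ?posrE // mulrAC.
have k1 : (1 : R) <= k%:R by rewrite ler1n.
have lk0 : 0 <= ln (k%:R : R) by apply: ln_ge0.
apply: ler_pM; rewrite ?divr_ge0 ?exprn_ge0 ?addr_ge0 ?mulr_ge0 ?ln_ge0 ?ler1n //.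
  by apply: sqr_div_1Dln_le => //; rewrite ler_nat.
by rewrite lerD2l ler_wpM2l // ler_ln ?posrE ?ltr0n // ler_nat.
Qed.

(** There are at most d factors, of total degree at most d, with product of lengths at most 2^d L;
    so the sum in [prod_eval_measure] is at most d (log 3 + log 2) + W <= 2 d + W <= 3 W. *)
Lemma eval_measure (d : nat) (L : R) (P : {poly int}) :
  (0 < d)%N -> 3 <= L -> P != 0 -> ((size P).-1 <= d)%N -> (zpoly_length P)%:~R <= L ->
  expR (- (62 * 10 ^+ 3) * (3 * measure_exponent d L)) <= `|zpoly_eval P (ln 2)|.
Proof.
move=> d0 L3 P0 sP PL.
have [l1 ld dW lW lam1] := measure_exponent_facts d0 L3.
have [c [ps [c0 irr PE]]] := zpoly_factorization P0.
have nz Q : Q \in ps -> Q != 0.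
  by move=> /irr [sQ _]; rewrite -size_poly_gt0 (ltn_trans _ sQ).
have ps0 : all (predC1 0) ps by apply/allP => Q /nz.
have prod0 : \prod_(Q <- ps) Q != 0.
  by rewrite prodf_seq_neq0; apply/allP => Q /nz.
have sizeE : (\sum_(Q <- ps) (size Q).-1)%N = (size P).-1.
  rewrite PE mul_polyC size_scale //.
  elim: ps nz {irr PE ps0 prod0} => [|Q ps IH] nz; first by rewrite !big_nil size_poly1.
  have Q0 : Q != 0 by apply: nz; rewrite mem_head.
  have prod0 : \prod_(Q <- ps) Q != 0.
    by rewrite prodf_seq_neq0; apply/allP => F Fps; apply: nz; rewrite inE Fps orbT.
  rewrite !big_cons IH => [|F Fps]; last by apply: nz; rewrite inE Fps orbT.
  rewrite size_mul //; move: Q0 prod0; rewrite -!size_poly_gt0.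
  have h a b : (0 < a -> 0 < b -> a.-1 + b.-1 = (a + b).-1.-1)%N by lia.
  exact: h.
have sd : (\sum_(Q <- ps) (size Q).-1 <= d)%N by rewrite sizeE.
have c1 : (1 : R) <= `|c%:~R| by rewrite -intr_norm -[1]/(1%:~R) ler_int -gtz0_ge1
  normr_gt0.
have evalE : `|zpoly_eval P (ln 2)| = `|c%:~R| * `|\prod_(Q <- ps) zpoly_eval Q (ln
  2)| :> R.
  rewrite PE zpoly_evalM zpoly_evalC normrM; congr (_ * `|_|).
  elim: (ps) => [|Q s IH]; first by rewrite !big_nil -[1]/(1%:P) zpoly_evalC.
  by rewrite !big_cons zpoly_evalM IH.
rewrite evalE; apply: le_trans (_ : `|\prod_(Q <- ps) zpoly_eval Q (ln 2)| <= _);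
  last by rewrite ler_peMl.
apply: le_trans (prod_eval_measure d0 irr sd).
rewrite ler_expR !mulNr lerN2 ler_wpM2l ?mulr_ge0 ?exprn_ge0 //.
set W := ln L + _ in dW lW.
have -> : 3 * measure_exponent d L = d%:R ^+ 2 / (1 + ln d%:R) * (3 * W).
  by rewrite /measure_exponent -/W; ring.
have lnd0 : 0 <= ln (d%:R : R) by apply: ln_ge0; rewrite ler1n.
apply: ler_wpM2l; first by rewrite divr_ge0 ?exprn_ge0 // addr_ge0.
rewrite !big_split /= -mulr_suml -natr_sum.
have lnlen : \sum_(Q <- ps) ln (zpoly_length Q)%:~R <= d%:R * ln 2 + ln L :> R.
  have lenQ Q : Q \in ps -> (0 : R) < (zpoly_length Q)%:~R.
    by move=> /nz Q0; rewrite ltr0z gtz0_ge1 zpoly_length_ge1.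
  have -> : \sum_(Q <- ps) ln (zpoly_length Q)%:~R = ln (\prod_(Q <- ps)
    (zpoly_length Q)%:~R : R).
    elim: (ps) lenQ => [|Q s IH] lenQ; first by rewrite !big_nil ln1.
    rewrite !big_cons lnM ?posrE ?lenQ ?mem_head ?IH //.
      by move=> F Fs; apply: lenQ; rewrite inE Fs orbT.
    by rewrite big_seq; apply: prodr_gt0 => F Fs; apply: lenQ; rewrite inE Fs orbT.
  have Lgt0 : 0 < L by apply: lt_le_trans L3.
  have -> : d%:R * ln 2 + ln L = ln (2 ^+ d * L).
    by rewrite lnM ?posrE ?exprn_gt0 // lnXn // -[ln 2 *+ d]mulr_natl.
  rewrite ler_ln ?posrE ?mulr_gt0 ?exprn_gt0 //; last first.
    by rewrite big_seq; apply: prodr_gt0 => Q Qps; apply: lenQ.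
  rewrite -rmorph_prod; have := prod_zpoly_length_le ps0.
  rewrite -(ler_int R) => /le_trans; apply; rewrite rmorphM rmorphXn /=.
  apply: ler_pM; rewrite ?exprn_ge0 ?ler0z ?zpoly_length_ge0 //.
    by apply: ler_weXn2l => //; rewrite ler1n.
  apply: le_trans PL; rewrite ler_int PE mul_polyC /zpoly_length size_scale //.
  apply: ler_sum => i _; rewrite coefZ normrM ler_peMl //.
  by rewrite -gtz0_ge1 normr_gt0.
have ln30 : 0 <= ln (3 : R) by apply: le_trans (ln3_ge1 R).
have sdR : (\sum_(Q <- ps) (size Q).-1)%:R <= d%:R :> R by rewrite ler_nat.
have lnn : \sum_(Q <- ps) ln 3 <= d%:R * ln 3 :> R.
  apply: le_trans (ler_wpM2r ln30 sdR); rewrite natr_sum mulr_suml.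
  rewrite big_seq [leRHS]big_seq; apply: ler_sum => Q /irr [sQ _].
  by rewrite ler_peMl // ler1n -subn1 subn_gt0.
have ln3_le : ln (3 : R) <= 5 / 4.
  have -> : (3 : R) = 2 * (3 / 2) by field.
  rewrite lnM ?posrE // ?divr_gt0 //; have := ln2_le R; have := @ln_le_sub1 R (3 / 2).
  by rewrite divr_gt0 // => /(_ isT); clear; lra.
have lnd : (\sum_(Q <- ps) (size Q).-1)%:R * ln d%:R <= d%:R * ln d%:R :> R.
  by rewrite ler_wpM2r.
apply: le_trans (lerD (lerD lnn lnlen) lnd) _.
have : d%:R * (ln 3 + ln 2) <= d%:R * 2 :> R.
  by rewrite ler_wpM2l //; have := ln2_le R; move: ln3_le; clear; lra.
by rewrite mulrDr; move: dW; rewrite /W; clear; lra.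
Qed.

End Main.

Theorem theorem3 (R : realType) :
  (forall (xi : R) (d : nat) (L : R),
     algebraic_number xi -> d = alg_degree xi ->
     3 <= L -> (alg_length xi)%:~R <= L ->
     expR (- (151 * 10 ^+ 3) * d%:R ^+ 2 * (ln L + d%:R * ln d%:R)
             * (1 + ln d%:R)^-1)
       <= `|ln 2 - xi|)
  /\
  (forall (d : nat) (L : R) (P : {poly int}),
     (1 <= d)%N -> 3 <= L ->
     P != 0 -> ((size P).-1 <= d)%N -> (zpoly_length P)%:~R <= L ->
     expR (- (26 * 10 ^+ 4) * d%:R ^+ 2 * (ln L + d%:R * ln d%:R)
             * (1 + ln d%:R)^-1)
       <= `|zpoly_eval P (ln 2)|).
Proof.
(* The constants obtained, 61000 and 3 * 62000 = 186000, are below the required 151000 and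
   260000. *)
have weaken (K K' : R) d L : (0 < d)%N -> 3 <= L -> K' <= K ->
    expR (- K * d%:R ^+ 2 * (ln L + d%:R * ln d%:R) * (1 + ln d%:R)^-1)
    <= expR (- K' * measure_exponent d L).
  move=> d0 L3 KK; rewrite -2!mulrA [X in - K * X]mulrA -/(measure_exponent d L)
    ler_expR.
  rewrite !mulNr lerN2 ler_wpM2r //.
  by apply: le_trans (measure_exponent_ge d0 L3); apply: exprn_ge0.
split=> [xi d L alg dE L3 lenL | d L P d0 L3 P0 sP lenL].
  have [irr _ root] := minpolyZP alg.
  have sP : size (minpolyZ xi) = d.+1.
    by rewrite dE /alg_degree prednK //; case: irr => /ltnW.
  have d0 : (0 < d)%N by case: irr; rewrite sP.
  apply: le_trans (real_root_measure irr sP lenL L3 root).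
  apply: weaken => //; rewrite ler_wpM2r ?exprn_ge0 // ler_nat //.
apply: le_trans (eval_measure d0 L3 P0 sP lenL).
have -> : - (62 * 10 ^+ 3) * (3 * measure_exponent d L) = - (62 * 10 ^+ 3 * 3) *
  measure_exponent d L :> R by ring.
apply: weaken => //; rewrite [10 ^+ 4]exprS mulrA mulrAC ler_wpM2r ?exprn_ge0 //.
by rewrite -!natrM ler_nat.
Qed.
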